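(* Let $I$ be an infinite set and, for each $i\in I$, let $A_i$ be a unital $^*$-algebra over $\mathbb C$, $H_i$ a non-zero Hilbert space and $\Psi_i:A_i\to\mathcal L(H_i)$ a unital $^*$-homomorphism. (a) The canonical homomorphism $\tilde\bigotimes_{i\in I}\Psi_i:\bigotimes_{i\in I}A_i\to L\big(\bigotimes_{i\in I}H_i\big)$ induces a unital $^*$-representation $$\bigotimes^{\phi_1}_{i\in I}\Psi_i:\bigotimes^{\rm ut}_{i\in I}A_i\to\mathcal L\Big(\bar\bigotimes^{\phi_1}_{i\in I}H_i\Big).$$ (b) $\Big(\bar\bigotimes^{\phi_1}_{i\in I}H_i,\ \big(\bigotimes^{\phi_1}_{i\in I}\Psi_i\big)\big|_{\bigotimes^e_{i\in I}A_i}\Big)=\bigoplus_{\mu\in\Omega^{\rm un}_{I;H}}\Big(\bar\bigotimes^\mu_{i\in I}H_i,\ \bigotimes^\mu_{i\in I}\Psi_i\Big)$. (c) If all $\Psi_i$ are injective, then so is $\bigotimes^{\phi_1}_{i\in I}\Psi_i$.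
   Context: $L(X)$ denotes the linear maps on $X$, $\mathcal L(H)$ the bounded linear operators on $H$. $\bigotimes_{i\in I}X_i$ is the vector space with a multilinear (linear in each variable separately) map $\Theta_X:x\mapsto\otimes_{i\in I}x_i$ from $\prod_{i\in I}X_i$ through which every multilinear map on $\prod_{i\in I}X_i$ factors via a unique linear map. For $x,y\in\prod_{i\in I}(X_i\setminus\{0\})$, $x\sim y$ means $x_i=y_i$ for all but finitely many $i$; for $\omega=[u]_\sim$, $\bigotimes^\omega_{i\in I}X_i=\bigotimes^u_{i\in I}X_i=\mathrm{span}\{\otimes_{i\in I}x_i:x_i=u_i\text{ for all but finitely many }i\}$. $\bigotimes_{i\in I}A_i$ is a $^*$-algebra with coordinatewise operations on elementary tensors. $U_{A}$ is the group of unitary elements ($a^*a=aa^*=1$) of $A$; $\Omega^{\rm ut}_{I;A}=\prod_{i\in I}U_{A_i}/\sim$; $\bigotimes^{\rm ut}_{i\in I}A_i=\bigoplus_{\omega\in\Omega^{\rm ut}_{I;A}}\bigotimes^\omega_{i\in I}A_i$, a unital $^*$-subalgebra of $\bigotimes_{i\in I}A_i$ containing the $^*$-subalgebra $\bigotimes^e_{i\in I}A_i$, where $e=[e_i]_{i\in I}$ is the family of identities. $\tilde\bigotimes_{i\in I}\Psi_i$ is the homomorphism with $(\tilde\bigotimes_{i\in I}\Psi_i)(\otimes a_i)(\otimes x_i)=\otimes_{i\in I}\Psi_i(a_i)x_i$. With $\mathfrak S_1(H_i)$ the unit sphere of $H_i$, $\Omega^{\rm un}_{I;H}=\prod_{i\in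 I}\mathfrak S_1(H_i)/\sim$ and $\bigotimes^{\rm un}_{i\in I}H_i=\mathrm{span}\,\Theta_H(\prod_{i\in I}\mathfrak S_1(H_i))$. This space carries the inner product $\langle\cdot,\cdot\rangle_{\phi_1}$ given, for $x,y\in\prod_{i\in I}\mathfrak S_1(H_i)$, by $\langle\otimes x_i,\otimes y_i\rangle_{\phi_1}=\prod_{i\in I}\langle x_i,y_i\rangle$ if $\langle x_i,y_i\rangle=1$ for all but finitely many $i$, and $0$ otherwise. $\bar\bigotimes^{\phi_1}_{i\in I}H_i$ and $\bar\bigotimes^\mu_{i\in I}H_i$ denote the completions of $\bigotimes^{\rm un}_{i\in I}H_i$ and of its subspace $\bigotimes^\mu_{i\in I}H_i$ ($\mu\in\Omega^{\rm un}_{I;H}$); $\bar\bigotimes^{\phi_1}_{i\in I}H_i$ is the Hilbert space direct sum of the $\bar\bigotimes^\mu_{i\in I}H_i$. $\bigotimes^\mu_{i\in I}\Psi_i:\bigotimes^e_{i\in I}A_i\to\mathcal L(\bar\bigotimes^\mu_{i\in I}H_i)$ is the unital $^*$-representation obtained by restricting $(\tilde\bigotimes_{i\in I}\Psi_i)(a)$, $a\in\bigotimes^e_{i\in I}A_i$, to the invariant subspace $\bigotimes^\mu_{i\in I}H_i$ and extending by continuity. *)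

(* Defs.v *)
From HB Require Import structures.
From mathcomp Require Import all_boot all_order all_algebra.
From mathcomp Require Import complex.
From mathcomp Require Import all_classical all_reals all_analysis.
Import Order.TTheory GRing.Theory Num.Theory.
Import numFieldNormedType.Exports.

Set Implicit Arguments.
Unset Strict Implicit.
Unset Printing Implicit Defensive.

Local Open Scope classical_set_scope.
Local Open Scope ring_scope.
Local Open Scope complex_scope.

HB.mixin Record Algebra_isStar (R : realType) A of GRing.Algebra R[i] A := {
  star : A -> A;
  starK : involutive star;
  star_semilinear : forall (c : R[i]) (a b : A),
    star (c *: a + b) = Num.conj c *: star a + star b;
  starM : forall a b : A, star (a * b) = star b * star a
}.

#[short(type="starAlgType")]
HB.structure Definition StarAlgebra (R : realType) :=
  {A of Algebra_isStar R A & GRing.Algebra R[i] A}.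

(* [hdot] is linear in its first and conjugate-linear in its second variable. *)
HB.mixin Record NormedModule_isHilbert (R : realType) H
    of CompleteNormedModule R[i] H := {
  hdot : {dot H for @Num.conj R[i]};
  sqr_norm_hdot : forall x : H, `|x| ^+ 2 = hdot x x
}.

#[short(type="hilbertType")]
HB.structure Definition Hilbert (R : realType) :=
  {H of NormedModule_isHilbert R H & CompleteNormedModule R[i] H}.

Definition almost_all (I : Type) (P : I -> Prop) : Prop :=
  finite_set [set i | ~ P i].

Section LinearAlgebra.
Variable R : realType.
Local Notation C := R[i].

Definition lspan (T : lmodType C) (S : set T) : set T :=
  [set v | exists (n : nat) (c : 'I_n -> C) (s : 'I_n -> T),
     (forall k, S (s k)) /\ v = \sum_(k < n) c k *: s k].

Definition multilinear (I : eqType) (X : I -> lmodType C) (W : lmodType C)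
    (f : (forall i, X i) -> W) : Prop :=
  forall (x : forall i, X i) (i : I), linear (fun v : X i => f (dfwith x i v)).

End LinearAlgebra.

Section TensorProduct.
Variables (R : realType) (I : eqType).
Local Notation C := R[i].
Variables (X : I -> lmodType C) (T : lmodType C) (theta : (forall i, X i) -> T).

Definition is_tensor_product : Prop :=
  multilinear theta /\
  forall (W : lmodType C) (f : (forall i, X i) -> W), multilinear f ->
    exists2 g : {linear T -> W}, (forall x, g (theta x) = f x) &
      forall h : {linear T -> W}, (forall x, h (theta x) = f x) -> h =1 g.

(* The linear map through which a multilinear [f] factors (and a dummy value
   when there is none). *)
Definition tensor_lift (W : lmodType C) (f : (forall i, X i) -> W) : T -> W :=
  if pselect (exists g : {linear T -> W}, forall x, g (theta x) = f x) is left h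
  then sval (cid h) else fun=> 0.

Lemma tensor_lift_linear (W : lmodType C) (f : (forall i, X i) -> W) :
  linear (tensor_lift f).
Proof.
rewrite /tensor_lift; case: pselect => [h|_] c u v; last by rewrite scaler0 addr0.
exact: linearP.
Qed.

Lemma tensor_liftE (W : lmodType C) (f : (forall i, X i) -> W) :
  is_tensor_product -> multilinear f -> forall x, tensor_lift f (theta x) = f x.
Proof.
move=> [_ univ] /univ[g gE _] x; rewrite /tensor_lift.
by case: pselect => [h|[]]; [case: cid | exists g].
Qed.

Lemma tensor_ext (W : lmodType C) (f g : T -> W) : is_tensor_product ->
  linear f -> linear g -> (forall x, f (theta x) = g (theta x)) -> f =1 g.
Proof.
move=> [mth univ] lf lg fg.
have mf : multilinear (f \o theta) by move=> x i c u v /=; rewrite mth lf.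
have [k _ uniq] := univ _ _ mf.
pose f' := HB.pack_for {linear T -> W} f (GRing.isLinear.Build _ _ _ _ f lf).
pose g' := HB.pack_for {linear T -> W} g (GRing.isLinear.Build _ _ _ _ g lg).
move=> t; have ft : f t = k t by exact: (uniq f' (fun=> erefl)).
by rewrite ft; apply/esym/(uniq g' (fun x => esym (fg x))).
Qed.

(* x ~ u *)
Definition cofin_eq (x u : forall i, X i) : Prop :=
  almost_all (fun i => x i = u i).

Definition tensor_at (u : forall i, X i) : set T :=
  lspan [set theta x | x in [set x | cofin_eq x u]].

(* The quotient of [\prod_i D i] by ~, a point being an equivalence class. *)
Definition cofin_classes (D : forall i, set (X i)) : Type :=
  {w : set (forall i, X i) | exists2 u, (forall i, D i (u i)) &
     w = [set x | (forall i, D i (x i)) /\ cofin_eq x u]}.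

Definition tensor_class (D : forall i, set (X i)) (w : cofin_classes D) : set T :=
  lspan (\bigcup_(u in sval w) [set theta x | x in [set x | cofin_eq x u]]).

End TensorProduct.

Section StarAlgebras.
Variables (R : realType) (I : eqType).

Definition unitary (A : starAlgType R) : set A :=
  [set a | star a * a = 1 /\ a * star a = 1].

(* The [*]-algebra operations of [T] are the coordinatewise ones. *)
Definition is_tensor_star_algebra (A : I -> starAlgType R) (T : starAlgType R)
    (theta : (forall i, A i) -> T) : Prop :=
  [/\ is_tensor_product theta,
      forall a b, theta (fun i => a i * b i) = theta a * theta b,
      theta (fun=> 1) = 1 &
      forall a, theta (fun i => star (a i)) = star (theta a)].

Definition tensor_ut (A : I -> starAlgType R) (T : starAlgType R)
    (theta : (forall i, A i) -> T) : set T :=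
  lspan (\bigcup_(w : cofin_classes (fun i => @unitary (A i)))
           tensor_class theta w).

Definition tensor_e (A : I -> starAlgType R) (T : starAlgType R)
    (theta : (forall i, A i) -> T) : set T :=
  tensor_at theta (fun=> 1).

End StarAlgebras.

Section Operators.
Variable R : realType.
Local Notation C := R[i].

Definition unit_sphere (H : hilbertType R) : set H := [set x | `|x| = 1].

Definition bounded_operator (H : hilbertType R) (f : H -> H) : Prop :=
  linear f /\ exists M : C, forall x, `|f x| <= M * `|x|.

(* [B] is meant to be a unital [*]-subalgebra of [A]; the values of [Pi]
   outside [B] are irrelevant. *)
Definition unital_star_repr (A : starAlgType R) (B : set A) (H : hilbertType R)
    (Pi : A -> H -> H) : Prop :=
  [/\ forall a, B a -> bounded_operator (Pi a),
      forall (c : C) a b, B a -> B b ->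
        forall x, Pi (c *: a + b) x = c *: Pi a x + Pi b x,
      forall a b, B a -> B b -> forall x, Pi (a * b) x = Pi a (Pi b x),
      forall x, Pi 1 x = x &
      forall a, B a -> forall x y, hdot (Pi (star a) x) y = hdot x (Pi a y)].

(* [K] with the embedding [j] is a completion of the subspace [V] of [T],
   endowed with the inner product [ip]. *)
Definition is_completion (T : lmodType C) (V : set T) (ip : T -> T -> C)
    (K : hilbertType R) (j : T -> K) : Prop :=
  [/\ forall (c : C) u v, V u -> V v -> j (c *: u + v) = c *: j u + j v,
      forall u v, V u -> V v -> hdot (j u) (j v) = ip u v &
      closure (j @` V) = setT].

(* Extension by continuity: the limit of [g v] as [j v] tends to [x], [v] in [V]. *)
Definition continuous_ext (T : Type) (V : set T) (K L : hilbertType R)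
    (j : T -> K) (g : T -> L) (x : K) : L :=
  lim (g @ filter_from (nbhs x) (fun U => V `&` j @^-1` U)).

(* [K] is the Hilbert space direct sum of the [Kmu m], embedded by [J m], and
   [Pi] is, on [B], the direct sum of the [Pimu m]. *)
Definition is_direct_sum_repr (A : Type) (B : set A) (M : Type)
    (K : hilbertType R) (Pi : A -> K -> K)
    (Kmu : M -> hilbertType R) (Pimu : forall m, A -> Kmu m -> Kmu m)
    (J : forall m, Kmu m -> K) : Prop :=
  [/\ forall m, linear (J m),
      forall m x y, hdot (J m x) (J m y) = hdot x y,
      forall m n x y, m <> n -> hdot (J m x) (J n y) = 0,
      closure (lspan (\bigcup_m range (J m))) = setT &
      forall a, B a -> forall m x, Pi a (J m x) = J m (Pimu m a x)].

End Operators.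

Section InfiniteTensor.
Variables (R : realType) (I : choiceType).
Local Notation C := R[i].
Variables (H : I -> hilbertType R) (TH : lmodType C).
Variable thH : (forall i, H i) -> TH.

Definition tensor_un : set TH :=
  lspan [set thH x | x in [set x | forall i, unit_sphere (x i)]].

Definition phi1 (x y : forall i, H i) : C :=
  if `[< almost_all (fun i => hdot (x i) (y i) = 1) >]
  then \big[*%R/1]_(i \in [set: I]) (hdot (x i) (y i)) else 0.

(* [phi1] is multilinear in [x] and conjugate-multilinear in [y] on all of
   [\prod_i H i], so it induces a sesquilinear form on the whole of [TH]; see
   [phi1_ipE].  Only its restriction to [tensor_un] is positive definite. *)
Definition phi1_ip (s t : TH) : C :=
  tensor_lift thH (W := C^o) (fun x =>
    Num.conj (tensor_lift thH (W := C^o) (fun y => Num.conj (phi1 x y)) t)) s.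

Definition tensor_op (A : I -> starAlgType R) (TA : starAlgType R)
    (thA : (forall i, A i) -> TA) (Psi : forall i, A i -> H i -> H i) :
    TA -> TH -> TH :=
  tensor_lift thA (W := TH -> TH)
    (fun a => tensor_lift thH (fun x => thH (fun i => Psi i (a i) (x i)))).

(* The operator induced by [tensor_op a] on the completion [K] of [V], by
   restriction to [V] and extension by continuity. *)
Definition tensor_repr (A : I -> starAlgType R) (TA : starAlgType R)
    (thA : (forall i, A i) -> TA) (Psi : forall i, A i -> H i -> H i)
    (V : set TH) (K : hilbertType R) (j : TH -> K) (a : TA) : K -> K :=
  continuous_ext V j (j \o tensor_op thA Psi a).

Lemma almost_all_eq (J : eqType) (P Q : J -> Prop) (i : J) :
  (forall k, k != i -> P k = Q k) -> almost_all P = almost_all Q.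
Proof.
have sub (P' Q' : J -> Prop) : (forall k, k != i -> P' k = Q' k) ->
    almost_all P' -> almost_all Q'.
  move=> PQ fP; apply: (@sub_finite_set _ _ ([set k | ~ P' k] `|` [set i])).
    by move=> k /= nQ; case: (eqVneq k i) => [->|/PQ e]; [right|left; rewrite e].
  by rewrite finite_setU; split => //; exact: finite_set1.
by move=> PQ; apply/propext; split; apply: sub => // k /PQ.
Qed.

Lemma fsprod_split (F : I -> C) (i : I) : almost_all (fun k => F k = 1) ->
  \big[*%R/1]_(k \in [set: I]) F k =
  F i * \big[*%R/1]_(k \in [set k | F k <> 1] `\ i) F k.
Proof.
move=> fF; set B := [set k | F k <> 1].
rewrite -(fsbig_widen (B `|` [set i]) setT F) //; last first.
  by move=> k [_ /=] /not_orP[/contrapT].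
rewrite (fsbigD1 i) /=; [|by rewrite finite_setU; split|by right].
by rewrite setDUl setDv setU0.
Qed.

Lemma phi1_dfwith (x y : forall i, H i) (i : I) :
  exists c : C, forall v, phi1 (dfwith x i v) y = c * hdot v (y i).
Proof.
pose P v := almost_all (fun k => hdot (dfwith x i v k) (y k) = 1).
have PE v : P v = P 0.
  apply: (@almost_all_eq _ _ _ i) => k ki.
  by rewrite !dfwithout // eq_sym.
have [P0|nP0] := pselect (P 0); last first.
  by exists 0 => v; rewrite /phi1 mul0r asboolF // -/(P v) PE.
exists (\big[*%R/1]_(k \in [set k | hdot (x k) (y k) <> 1] `\ i) hdot (x k) (y k)) => v.
have Pv : P v by rewrite PE.
rewrite /phi1 asboolT // (fsprod_split i Pv) dfwithin mulrC; congr (_ * _).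
have -> : [set k | hdot (dfwith x i v k) (y k) <> 1] `\ i =
          [set k | hdot (x k) (y k) <> 1] `\ i.
  apply/seteqP; split=> k [/= h ki]; split => //; move: h;
    by rewrite dfwithout //; apply/eqP => e; apply: ki.
apply: eq_fsbigr => k; rewrite inE => -[_ /= ki].
by rewrite dfwithout //; apply/eqP => e; apply: ki.
Qed.

Lemma phi1_multilinear (y : forall i, H i) :
  multilinear (W := C^o) (fun x => phi1 x y).
Proof.
move=> x i c u v; have [d dE] := phi1_dfwith x y i.
by rewrite !dE linearDl linearZl_LR /= mulrDr mulrCA.
Qed.

Lemma phi1C (x y : forall i, H i) : phi1 y x = Num.conj (phi1 x y).
Proof.
have hC k : hdot (y k) (x k) = Num.conj (hdot (x k) (y k)).
  by rewrite hermC /= expr0 mul1r.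
have eP : almost_all (fun i => hdot (y i) (x i) = 1) =
          almost_all (fun i => hdot (x i) (y i) = 1).
  congr almost_all; apply/funext => k; rewrite hC; apply/propext; split.
    by move=> /(congr1 Num.conj); rewrite conjCK conjC1.
  by move=> ->; rewrite conjC1.
rewrite /phi1 eP; case: asboolP => fin; last by rewrite conjC0.
have fin' := fin; rewrite -eP in fin'.
rewrite -(fsbig_widen [set k | hdot (x k) (y k) <> 1] setT (fun k => hdot (x k) (y k))) //;
  last by move=> k [_ /= /contrapT].
rewrite -(fsbig_widen [set k | hdot (x k) (y k) <> 1] setT (fun k => hdot (y k) (x k))) //;
  last by move=> k [_ /= /contrapT]; rewrite hC => ->; rewrite conjC1.
rewrite !fsbig_finite //= rmorph_prod /=.
by apply: eq_bigr => k _; rewrite hC.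
Qed.

Lemma phi1_ipE : is_tensor_product thH ->
  forall x y, phi1_ip (thH x) (thH y) = phi1 x y.
Proof.
move=> tH.
have mc (x : forall i, H i) : multilinear (W := C^o) (fun y => Num.conj (phi1 x y)).
  have -> : (fun y => Num.conj (phi1 x y)) = (fun y => phi1 y x).
    by apply/funext => y; exact/esym/phi1C.
  exact: phi1_multilinear.
pose F (x : forall i, H i) : TH -> C^o := tensor_lift thH (W := C^o) (fun y => Num.conj (phi1 x y)).
have FE x y : F x (thH y) = Num.conj (phi1 x y) by rewrite /F tensor_liftE.
have FL x : linear (F x) by exact: tensor_lift_linear.
suff mF t : multilinear (W := C^o) (fun x => Num.conj (F x t)).
  by move=> x y; have := tensor_liftE tH (mF (thH y)) x; rewrite FE conjCK.
move=> x i c u v /=.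
set xw := dfwith x i (c *: u + v); set xu := dfwith x i u; set xv := dfwith x i v.
suff -> : F xw t = Num.conj c * F xu t + F xv t.
  by rewrite rmorphD rmorphM /= conjCK.
pose G (t : TH) : C^o := Num.conj c * F xu t + F xv t.
have GL : linear G.
  move=> a s s'; rewrite /G !FL mulrDr addrACA.
  have -> : Num.conj c * (a *: F xu s) = a *: (Num.conj c * F xu s).
    exact: mulrCA.
  by rewrite -scalerDr.
apply: (tensor_ext tH (FL xw) GL) => y.
rewrite /G !FE /xw (phi1_multilinear y x c u v) /=.
by rewrite rmorphD rmorphM.
Qed.

Lemma tensor_opE (A : I -> starAlgType R) (TA : starAlgType R)
    (thA : (forall i, A i) -> TA) (Psi : forall i, A i -> H i -> H i) :
  is_tensor_product thA -> is_tensor_product thH ->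
  (forall i, unital_star_repr setT (Psi i)) ->
  forall a x,
    tensor_op thA Psi (thA a) (thH x) = thH (fun i => Psi i (a i) (x i)).
Proof.
move=> tA tH PsiR.
have thHm := tH.1.
pose Pf (a : forall i, A i) (x : forall i, H i) i := Psi i (a i) (x i).
have Pfx a x i v : Pf a (dfwith x i v) = dfwith (Pf a x) i (Psi i (a i) v).
  apply: functional_extensionality_dep => k; rewrite /Pf.
  case: (eqVneq i k) => [<-|ik]; first by rewrite !dfwithin.
  by rewrite !dfwithout.
have Pfa a x i b : Pf (dfwith a i b) x = dfwith (Pf a x) i (Psi i b (x i)).
  apply: functional_extensionality_dep => k; rewrite /Pf.
  case: (eqVneq i k) => [<-|ik]; first by rewrite !dfwithin.
  by rewrite !dfwithout.
have mx a : multilinear (fun x => thH (Pf a x)).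
  move=> x i c u v; rewrite !Pfx -thHm; congr (thH (dfwith _ _ _)).
  have [bd _ _ _ _] := PsiR i; have [lin _] := bd (a i) Logic.I.
  exact: lin.
pose L a := tensor_lift thH (fun x => thH (Pf a x)).
have LE a x : L a (thH x) = thH (Pf a x) by rewrite /L tensor_liftE.
have LL a : linear (L a) by exact: tensor_lift_linear.
have ma : multilinear (W := TH -> TH) L.
  move=> a i c b b'; apply/funext => t.
  apply: (@tensor_ext _ _ _ _ _ TH (L (dfwith a i (c *: b + b')))
    (fun t => (c *: L (dfwith a i b) + L (dfwith a i b')) t) tH) => //.
    move=> d s s'; rewrite !fctE !LL !scalerDr addrACA; congr (_ + _ + _).
    by rewrite !scalerA mulrC.
  move=> x; rewrite !fctE !LE !Pfa -thHm; congr (thH (dfwith _ _ _)).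
  have [_ lin _ _ _] := PsiR i; exact: lin.
by move=> a x; have -> : tensor_op thA Psi (thA a) = L a by exact: (tensor_liftE tA ma).
Qed.

End InfiniteTensor.

(* Main.v *)
(* A positive power bound replaces the spectral theory of tensor products of
   operators: if [S = T^* T] on a pre-Hilbert space and [p n = |S^n s|], then
   [p n ^ 2 <= p (2 n) p 0], so [p n = O(Q^n)] for each [s], with [Q] fixed but
   the constant arbitrary, already gives [|T s|^2 <= Q |s|^2].  For [T] the
   operator of an elementary tensor [a] that is unitary at almost all
   coordinates, such a [Q] is visible on elementary tensors, [S^n] being the
   identity at almost all coordinates.

   For injectivity, slice an element of the kernel by the matrix coefficients
   of [Psi i] at the finitely many coordinates where its elementary tensors are
   not unitary or differ accidentally.  The result is a combination of tensors
   of unitaries, any two of which are equal or differ at infinitely many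
   coordinates; a family of unit vectors separating these unitaries sends the
   different ones to orthogonal vectors, so the slices vanish, and matrix
   coefficients separate the points of [A i]. *)
Require Import Defs.
From HB Require Import structures.
From mathcomp Require Import all_boot all_order all_algebra.
From mathcomp Require Import complex.
From mathcomp Require Import all_classical all_reals all_analysis.
From mathcomp Require Import ring.
Import Order.TTheory GRing.Theory Num.Theory.
Import numFieldNormedType.Exports.

Set Implicit Arguments.
Unset Strict Implicit.
Unset Printing Implicit Defensive.

Local Open Scope classical_set_scope.
Local Open Scope ring_scope.

(** * Lipschitz maps between normed modules and density arguments *)

Section Lipschitz.
Variable C : numFieldType.
Implicit Types K L : normedModType C.

Definition lipschitz_map K L (f : K -> L) : Prop :=
  exists2 M : C, 0 <= M & forall x y, `|f x - f y| <= M * `|x - y|.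

Lemma eq_norm_small L (M : C) (x y : L) : 0 <= M ->
  (forall e, 0 < e -> `|x - y| <= M * e) -> x = y.
Proof.
move=> M0 xy; apply/eqP; rewrite -subr_eq0 -normr_le0.
(* [M] may be zero, so the division is by [M + 1]; the same device recurs below. *)
have M1 : 0 < M + 1 by rewrite ltr_wpDl.
apply/ler_addgt0Pr => e e0; rewrite add0r.
apply: (le_trans (xy _ (divr_gt0 e0 M1))).
by rewrite mulrCA ler_piMr ?(ltW e0)// ler_pdivrMr// mul1r lerDl.
Qed.

Lemma dense_approx K (D : set K) (x : K) (e : C) :
  closure D = setT -> 0 < e -> exists2 v, D v & `|x - v| < e.
Proof.
move=> DT e0; have : closure D x by rewrite DT.
by move=> /(_ _ (nbhsx_ballx x e e0))[v [Dv]]; rewrite -ball_normE; exists v.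
Qed.

(** A detour through a point [v] of [D] with [|x - v| < e] bounds the difference at [x] by
    [(M + N) * e]. Identities on a completion are reduced by this to vectors coming from the
    incomplete space. *)
Lemma dense_lipschitz_eq K L (D : set K) (f g : K -> L) :
  closure D = setT -> lipschitz_map f -> lipschitz_map g ->
  (forall x, D x -> f x = g x) -> f =1 g.
Proof.
move=> DT [M M0 fM] [N N0 gN] fg x; apply: (@eq_norm_small _ (M + N)).
  exact: addr_ge0.
move=> e e0; have [v /fg fgv xv] := dense_approx x DT e0.
have -> : f x - g x = (f x - f v) - (g x - g v) by rewrite fgv opprB subrKA.
apply: (le_trans (ler_normB _ _)); rewrite mulrDl lerD//.
  by rewrite (le_trans (fM _ _))// ler_wpM2l// ltW.
by rewrite (le_trans (gN _ _))// ler_wpM2l// ltW.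
Qed.

Lemma lipschitz_map_comp K L (P : normedModType C) (f : L -> P) (g : K -> L) :
  lipschitz_map f -> lipschitz_map g -> lipschitz_map (f \o g).
Proof.
move=> [M M0 fM] [N N0 gN]; exists (M * N); first exact: mulr_ge0.
by move=> x y; rewrite (le_trans (fM _ _))// -mulrA ler_wpM2l.
Qed.

Lemma lipschitz_mapD K L (f g : K -> L) :
  lipschitz_map f -> lipschitz_map g -> lipschitz_map (fun x => f x + g x).
Proof.
move=> [M M0 fM] [N N0 gN]; exists (M + N); first exact: addr_ge0.
move=> x y; rewrite opprD addrACA mulrDl (le_trans (ler_normD _ _))//.
exact: lerD.
Qed.

Lemma lipschitz_mapZ K L (c : C) (f : K -> L) :
  lipschitz_map f -> lipschitz_map (fun x => c *: f x).
Proof.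
move=> [M M0 fM]; exists (`|c| * M); first exact: mulr_ge0.
by move=> x y; rewrite -scalerBr normrZ -mulrA ler_wpM2l.
Qed.

Lemma lipschitz_map_id K : lipschitz_map (@id K).
Proof. by exists 1 => // x y; rewrite mul1r. Qed.

Lemma lipschitz_map_cst K L (a : L) : lipschitz_map (fun _ : K => a).
Proof. by exists 0 => // x y; rewrite subrr normr0 mul0r. Qed.

End Lipschitz.

(** * Extension by continuity from a dense image *)

Section ContinuousExtension.
Variables (R : realType) (T : lmodType R[i]) (V : set T).
Variables (K L : hilbertType R) (j : T -> K) (g : T -> L) (M : R[i]).
Hypotheses (jdense : closure (j @` V) = setT) (M0 : 0 <= M).
Hypothesis gM : forall v w, V v -> V w -> `|g v - g w| <= M * `|j v - j w|.

Local Notation ext := (continuous_ext V j g).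

Lemma continuous_ext_dist (x : K) (v : T) :
  V v -> `|ext x - g v| <= M * `|x - j v|.
Proof.
move=> Vv; pose F := filter_from (nbhs x) (fun U => V `&` j @^-1` U).
have approx (U : set K) : nbhs x U -> exists2 w, V w & U (j w).
  have : closure (j @` V) x by rewrite jdense.
  by move=> cl /cl [_ [[w Vw <-] Uw]]; exists w.
have FF : ProperFilter F.
  apply: filter_from_proper; last by move=> U /approx[w Vw Uw]; exists w.
  apply: filter_from_filter; first by exists setT; exact: filterT.
  move=> U W xU xW; exists (U `&` W); first exact: filterI.
  by move=> w [Vw [Uw Ww]].
have gF : cauchy (g @ F).
  apply: cauchy_exP => e e0.
  have M1 : 0 < M + 1 by rewrite ltr_wpDl.
  (* Two points within [d] of [x] have images at distance at most [M * (2 * d)], which is below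
     [e]. *)
  pose d := e / (M + 1) / 2.
  have d0 : 0 < d by rewrite !divr_gt0.
  have [w Vw xw] := approx _ (nbhsx_ballx x d d0).
  exists (g w); exists (ball x d); first exact: nbhsx_ballx.
  move=> u [Vu xu]; rewrite /= -ball_normE /=.
  apply: (le_lt_trans (gM Vw Vu)).
  apply: (@le_lt_trans _ _ (M * (e / (M + 1)))); last first.
    by rewrite mulrCA gtr_pMr// ltr_pdivrMr// mul1r ltrDl.
  apply: ler_wpM2l => //; rewrite [leRHS]splitr.
  rewrite -(subrKA x) (le_trans (ler_normD _ _))// lerD// ltW//.
    by rewrite distrC; move: xw; rewrite -ball_normE.
  by move: xu; rewrite /= -ball_normE.
have gl : g @ F --> ext x by exact/cauchy_cvgP.
apply/ler_addgt0Pr => e e0.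
have M1 : 0 < M + 1 by rewrite ltr_wpDl.
pose d := e / (M + 1); have d0 : 0 < d by rewrite divr_gt0.
have /(_ _ (nbhsx_ballx _ _ d0))[U xU UV] := gl.
have [w Vw [Uw xw]] := approx _ (filterI xU (nbhsx_ballx x d d0)).
have lw : `|ext x - g w| <= d.
  by have := UV w (conj Vw Uw); rewrite /= -ball_normE /= => /ltW.
rewrite -(subrKA (g w)) (le_trans (ler_normD _ _))//.
have -> : M * `|x - j v| + e = d + M * (d + `|x - j v|).
  rewrite mulrDr addrA [RHS]addrC; congr (_ + _).
  by rewrite -[X in _ = X + _]mul1r -mulrDl addrC /d mulrC divfK// gt_eqF.
rewrite lerD// (le_trans (gM Vw Vv))// ler_wpM2l// -(subrKA x).
rewrite (le_trans (ler_normD _ _))// lerD2r ltW// distrC.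
by move: xw; rewrite -ball_normE.
Qed.

Lemma continuous_extE (v : T) : V v -> ext (j v) = g v.
Proof.
move=> Vv; apply/eqP; rewrite -subr_eq0 -normr_le0.
by apply: (le_trans (continuous_ext_dist _ Vv)); rewrite subrr normr0 mulr0.
Qed.

Lemma lipschitz_continuous_ext : lipschitz_map ext.
Proof.
exists M => // x y; apply/ler_addgt0Pr => e e0.
have M1 : 0 < 2 * M + 1 by rewrite ltr_wpDl// mulr_ge0.
(* Only [x] is approximated by [j v]: the detour over [g v] costs at most [M * (d + |y - x| + d)],
   and [2 * M * d <= e]. *)
pose d := e / (2 * M + 1); have d0 : 0 < d by rewrite divr_gt0.
have [_ [v Vv <-] xv] := dense_approx x jdense d0.
rewrite -(subrKA (g v)) (le_trans (ler_normD _ _))//.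
rewrite (le_trans (lerD (continuous_ext_dist x Vv) (lexx _)))//.
rewrite [X in _ + X]distrC.
rewrite (le_trans (lerD (lexx _) (continuous_ext_dist y Vv)))//.
rewrite -(subrKA x y) -mulrDr (@le_trans _ _ (M * (2 * d + `|x - y|)))//.
  rewrite ler_wpM2l// (@le_trans _ _ (d + (`|y - x| + d)))//.
    by rewrite lerD ?(ltW xv)// (le_trans (ler_normD _ _))// lerD2l ltW.
  by rewrite distrC le_eqVlt; apply/orP; left; apply/eqP; ring.
rewrite mulrDr addrC lerD2l mulrA [M * 2]mulrC /d mulrCA.
by rewrite ler_piMr ?(ltW e0)// ler_pdivrMr// mul1r lerDl.
Qed.

(** Density is applied to one variable at a time: to [x] with [y] fixed, then to [y] with
    [x = j v]. *)
Lemma linear_continuous_ext :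
  (forall (c : R[i]) u v, V u -> V v -> V (c *: u + v)) ->
  (forall (c : R[i]) u v, V u -> V v -> j (c *: u + v) = c *: j u + j v) ->
  (forall (c : R[i]) u v, V u -> V v -> g (c *: u + v) = c *: g u + g v) ->
  linear ext.
Proof.
move=> VL jL gL c x y.
have lip := lipschitz_continuous_ext.
have add_lip (a : K) : lipschitz_map (fun x : K => a + x).
  by apply: lipschitz_mapD; [exact: lipschitz_map_cst|exact: lipschitz_map_id].
have lipc (a : K) : lipschitz_map (fun x : K => c *: x + a).
  apply: lipschitz_mapD; last exact: lipschitz_map_cst.
  exact/lipschitz_mapZ/lipschitz_map_id.
move: x; apply: (dense_lipschitz_eq jdense).
- exact: (lipschitz_map_comp lip (lipc y)).
- by apply: lipschitz_mapD; [exact: lipschitz_mapZ|exact: lipschitz_map_cst].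
move=> _ [v Vv <-]; move: y; apply: (dense_lipschitz_eq jdense).
- exact: (lipschitz_map_comp lip (add_lip (c *: j v))).
- by apply: lipschitz_mapD; [exact: lipschitz_map_cst|].
move=> _ [w Vw <-].
by rewrite -jL// !continuous_extE ?gL//; exact: VL.
Qed.

End ContinuousExtension.

(** * Cauchy-Schwarz and unit vectors *)

Section HilbertSpace.
Variables (R : realType) (H : hilbertType R).
Implicit Types x y : H.

Lemma hdotC x y : hdot y x = Num.conj (hdot x y).
Proof. by rewrite hermC /= expr0 mul1r. Qed.

Lemma hdotDl x y z : hdot (x + y) z = hdot x z + hdot y z.
Proof. exact: linearDl. Qed.

Lemma hdotZl (c : R[i]) x y : hdot (c *: x) y = c * hdot x y.
Proof. exact: linearZl_LR. Qed.

Lemma hdotBl x y z : hdot (x - y) z = hdot x z - hdot y z.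
Proof. exact: linearBl. Qed.

Lemma hdotDr x y z : hdot x (y + z) = hdot x y + hdot x z.
Proof. exact: linearDr. Qed.

Lemma hdotZr (c : R[i]) x y : hdot x (c *: y) = Num.conj c * hdot x y.
Proof. exact: linearZr_LR. Qed.

Lemma hdotBr x y z : hdot x (y - z) = hdot x y - hdot x z.
Proof. exact: linearBr. Qed.

Lemma norm_hdot_le x y : `|hdot x y| <= `|x| * `|y|.
Proof.
have [->|y0] := eqVneq y 0; first by rewrite linear0r !normr0 mulr0.
rewrite -(@ler_pXn2r _ 2) ?nnegrE ?mulr_ge0// exprMn.
have yy : 0 < `|y| ^+ 2 by rewrite exprn_gt0 ?normr_gt0.
rewrite -subr_ge0 -(pmulr_rge0 _ yy).
(* [z] is [|y| ^+ 2] times the component of [x] orthogonal to [y]. *)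
pose z := `|y| ^+ 2 *: x - hdot x y *: y.
suff -> : `|y| ^+ 2 * (`|x| ^+ 2 * `|y| ^+ 2 - `|hdot x y| ^+ 2) = `|z| ^+ 2.
  by rewrite exprn_ge0.
have conjy : Num.conj (`|y| ^+ 2) = `|y| ^+ 2.
  by apply: CrealP; rewrite realX// normr_real.
rewrite (sqr_norm_hdot z) /z hdotBl !hdotBr !hdotZl !hdotZr conjy -!sqr_norm_hdot.
rewrite normCK (hdotC x y).
ring.
Qed.

Lemma lipschitz_hdotl (y : H) :
  lipschitz_map (fun x : H => hdot x y : R[i]^o).
Proof.
exists `|y| => // u v; rewrite -hdotBl mulrC; exact: norm_hdot_le.
Qed.

(** Conjugation exchanges the two variables of [hdot]; density arguments in the second variable
    therefore start by conjugating both sides with [conjCK]. *)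
Lemma lipschitz_hdotr (x : H) :
  lipschitz_map (fun y : H => Num.conj (hdot x y) : R[i]^o).
Proof.
have -> : (fun y => Num.conj (hdot x y)) = (fun y => hdot y x).
  by apply/funext => y; rewrite -hdotC.
exact: lipschitz_hdotl.
Qed.

Lemma unit_vector_inner x : unit_sphere x -> hdot x x = 1.
Proof. by rewrite -sqr_norm_hdot => ->; rewrite expr1n. Qed.

(** Equality case of Cauchy-Schwarz: [|x - y| ^+ 2] expands to [1 - 1 - 1 + 1]. This is how a
    nonzero value of [phi1] forces unit vectors to agree at almost all coordinates. *)
Lemma unit_vector_eq x y :
  unit_sphere x -> unit_sphere y -> hdot x y = 1 -> x = y.
Proof.
move=> xx yy xy; apply/eqP; rewrite -subr_eq0 -normr_eq0 -sqrf_eq0.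
rewrite sqr_norm_hdot hdotBl !hdotBr !unit_vector_inner// (hdotC x y) xy conjC1.
by rewrite !subrr.
Qed.

Lemma normalize_unit x : x != 0 -> unit_sphere (`|x|^-1 *: x).
Proof.
move=> x0; rewrite /unit_sphere /= normrZ normfV normr_id mulVf//.
by rewrite normr_eq0.
Qed.

Lemma scaled_unit_vector x : (exists e : H, e != 0) ->
  exists c e, unit_sphere e /\ x = c *: e.
Proof.
move=> [e e0]; have [->|x0] := eqVneq x 0.
  exists 0, (`|e|^-1 *: e); split; last by rewrite scale0r.
  exact: normalize_unit.
exists `|x|, (`|x|^-1 *: x); split; first exact: normalize_unit.
by rewrite scalerA divff ?normr_eq0// scale1r.
Qed.

End HilbertSpace.

(** * Growth of sequences with a doubling inequality *)

Lemma bernoulli_ineq (R : realDomainType) (t : R) (n : nat) :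
  0 <= t -> 1 + n%:R * t <= (1 + t) ^+ n.
Proof.
move=> t0; elim: n => [|n IH]; first by rewrite mul0r addr0.
rewrite exprS; apply: (le_trans _ (ler_wpM2l _ IH)); last by rewrite addr_ge0.
rewrite -natr1 -subr_ge0.
have -> : (1 + t) * (1 + n%:R * t) - (1 + (n%:R + 1) * t) = n%:R * (t * t) by ring.
by rewrite !mulr_ge0.
Qed.

(** With [r] the ratio of [p 1] to [p 0], repeated doubling gives [p 0 * r ^+ (2 ^ k) <= p (2 ^ k)
    <= c * M ^+ (2 ^ k)]. If [r > M], the powers of [r / M] would stay below [c / p 0], against
    Bernoulli. The constant [c] thus disappears from the conclusion. *)
Lemma doubling_growth_bound (R : realType) (p : nat -> R) (c M : R) :
  0 < M -> (forall n, 0 <= p n) -> (forall n, p n ^+ 2 <= p n.*2 * p 0%N) ->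
  (forall n, p n <= c * M ^+ n) -> p 1%N <= M * p 0%N.
Proof.
move=> M0 p_ge0 pD pM; rewrite leNgt; apply/negP => Mp.
(* If [p 0] vanished, the doubling inequality at 1 would force [p 1 = 0], against [Mp]. *)
have p0 : 0 < p 0%N.
  rewrite lt_def p_ge0 andbT; apply/eqP => p00; move: Mp (pD 1%N).
  rewrite p00 mulr0 mulr0 => p1.
  by rewrite leNgt exprn_gt0.
pose r := p 1%N / p 0%N.
have pr k : p 0%N * r ^+ (2 ^ k) <= p (2 ^ k)%N.
  elim: k => [|k IH]; first by rewrite expn0 expr1 /r mulrCA divff ?gt_eqF// mulr1.
  rewrite -(ler_pM2r p0) expnS mul2n; apply: (le_trans _ (pD _)).
  have -> : p 0%N * r ^+ (2 ^ k).*2 * p 0%N = (p 0%N * r ^+ (2 ^ k)) ^+ 2.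
    by rewrite -addnn exprD; ring.
  by rewrite ler_pXn2r ?nnegrE ?p_ge0// mulr_ge0 ?exprn_ge0 ?divr_ge0.
pose t := r / M - 1.
have t0 : 0 < t by rewrite subr_gt0 ltr_pdivlMr// mul1r ltr_pdivlMr.
have bnd k : 1 + k%:R * t <= c / p 0%N.
  rewrite ler_pdivlMr//; apply: (@le_trans _ _ ((1 + t) ^+ (2 ^ k) * p 0%N)).
    rewrite ler_pM2r//; apply: (le_trans _ (bernoulli_ineq _ (ltW t0))).
    by rewrite lerD2l ler_pM2r// ler_nat ltnW// ltn_expl.
  rewrite /t addrC subrK expr_div_n mulrAC ler_pdivrMr ?exprn_gt0// mulrC.
  exact: (le_trans (pr k)).
(* An Archimedean choice of [k] makes [k * t] exceed [c / p 0], which contradicts [bnd k]. *)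
have := bnd (Num.bound (c / p 0%N / t)).
have c0 : 0 <= c / p 0%N.
  by rewrite divr_ge0// -[c]mulr1 -(expr0 M) (le_trans _ (pM 0%N)).
have := archi_boundP (divr_ge0 c0 (ltW t0)).
rewrite ltr_pdivrMr// => lt1 /le_lt_trans /(_ lt1).
by rewrite ltNge lerDr ler01.
Qed.

(** Norms take values in [R[i]], whose nonnegative elements are real, so taking real parts reduces
    the claim to the real one. *)
Lemma doubling_growth_boundC (R : realType) (p : nat -> R[i]) (c M : R[i]) :
  0 < M -> 0 <= c -> (forall n, 0 <= p n) ->
  (forall n, p n ^+ 2 <= p n.*2 * p 0%N) ->
  (forall n, p n <= c * M ^+ n) -> p 1%N <= M * p 0%N.
Proof.
move=> M0 c0 p_ge0 pD pM.
pose re (z : R[i]) : R := complex.Re z.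
have reE (z : R[i]) : 0 <= z -> z = (re z)%:C%C.
  by move=> z0; rewrite RRe_real// ger0_real.
have pE n := reE _ (p_ge0 n); have cE := reE _ c0; have ME := reE _ (ltW M0).
rewrite pE ME (pE 0%N) -rmorphM lecR; apply: (@doubling_growth_bound _ (re \o p) (re c)).
- by rewrite -ltcR -ME.
- by move=> n; rewrite -lecR -pE.
- by move=> n; rewrite -lecR rmorphXn rmorphM /= -!pE.
- by move=> n; rewrite -lecR rmorphM rmorphXn /= -pE -cE -ME.
Qed.

(** * Linear spans and conditions at almost all indices *)

Section Span.
Variables (R : realType) (T : lmodType R[i]).
Implicit Types S : set T.

Lemma lspan_gen S s : S s -> lspan S s.
Proof.
move=> Ss; exists 1%N, (fun=> 1), (fun=> s); split => //.
by rewrite big_ord1 scale1r.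
Qed.

Lemma lspan0 S : lspan S 0.
Proof. by exists 0%N, (fun=> 0), (fun=> 0); rewrite big_ord0; split => // -[]. Qed.

Lemma lspan_linear S (c : R[i]) u v :
  lspan S u -> lspan S v -> lspan S (c *: u + v).
Proof.
move=> [n [a [s [Ss ->]]]] [m [b [t [St ->]]]].
exists (n + m)%N, (fun k => match fintype.split k with inl i => c * a i | inr i => b i end),
  (fun k => match fintype.split k with inl i => s i | inr i => t i end); split.
  by move=> k; case: (fintype.split k) => i.
rewrite big_split_ord /= scaler_sumr; congr (_ + _); apply: eq_bigr => k _.
  by rewrite -/(unsplit (inl k)) unsplitK scalerA.
by rewrite -/(unsplit (inr k)) unsplitK.
Qed.

(** The induction step keeps [lspan S v] because the embedding [j] into a completion is known to be
    additive only on the completed subspace. *)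
Lemma lspan_ind S (P : T -> Prop) : P 0 ->
  (forall (c : R[i]) s v, S s -> lspan S v -> P v -> P (c *: s + v)) ->
  forall v, lspan S v -> P v.
Proof.
move=> P0 PS v [n [c [s [Ss ->]]]].
elim: n c s Ss => [c s _|n IH c s Ss]; first by rewrite big_ord0.
rewrite big_ord_recl; apply: PS => //; last exact: IH.
by exists n, (fun k => c (lift ord0 k)), (fun k => s (lift ord0 k)).
Qed.

Lemma lspanZ S (c : R[i]) u : lspan S u -> lspan S (c *: u).
Proof. by move=> Su; rewrite -[_ *: _]addr0; apply: lspan_linear => //; exact: lspan0. Qed.

Lemma lspan_sub S S' : S `<=` lspan S' -> lspan S `<=` lspan S'.
Proof.
move=> SS'; apply: lspan_ind; first exact: lspan0.
by move=> c s v /SS' Ss _; exact: lspan_linear.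
Qed.

End Span.

Section AlmostAll.
Variable I : Type.
Implicit Types P Q : I -> Prop.

Lemma almost_all_sub P Q : (forall i, P i -> Q i) -> almost_all P -> almost_all Q.
Proof. by move=> PQ; apply: sub_finite_set => i /= nQ /PQ. Qed.

Lemma almost_allT P : (forall i, P i) -> almost_all P.
Proof.
move=> PT; rewrite /almost_all (_ : [set i | ~ P i] = set0); first exact: finite_set0.
by apply/seteqP; split => // i /=; apply.
Qed.

Lemma almost_all_and P Q :
  almost_all P -> almost_all Q -> almost_all (fun i => P i /\ Q i).
Proof.
move=> fP fQ; apply: (@sub_finite_set _ _ ([set i | ~ P i] `|` [set i | ~ Q i])).
  by move=> i /= /not_andP[]; [left|right].
by rewrite finite_setU; split.
Qed.

End AlmostAll.

Lemma almost_all_seqP (I : eqType) (P : I -> Prop) :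
  almost_all P <-> exists s : seq I, forall i, i \notin s -> P i.
Proof.
split=> [/finite_seqP[s sE]|[s sP]].
  exists s => i; apply: contraNP => nP.
  by have : [set i | ~ P i] i by []; rewrite sE.
apply: (@sub_finite_set _ _ [set` s]) => [i /= nP|]; last exact: finite_seq.
by apply: contrapT => /negP /sP.
Qed.

(** * Unitaries and representations of a single algebra *)

Section Unitary.
Variables (R : realType) (A : starAlgType R).
Implicit Types a b : A.

Lemma star0 : star (0 : A) = 0.
Proof.
have := star_semilinear 1 (0 : A) 0.
rewrite scale1r addr0 rmorph1 scale1r => /eqP.
by rewrite -subr_eq subrr eq_sym => /eqP.
Qed.

Lemma star1 : star (1 : A) = 1.
Proof. by rewrite -[LHS]mulr1 -[X in _ * X](starK (1 : A)) -starM mulr1 starK. Qed.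

Lemma unitary1 : unitary (1 : A).
Proof. by rewrite /unitary /= star1 mulr1. Qed.

Lemma unitary_star a : unitary a -> unitary (star a).
Proof. by move=> [aa a'a]; rewrite /unitary /= starK. Qed.

Lemma unitaryM a b : unitary a -> unitary b -> unitary (a * b).
Proof.
move=> [a1 a2] [b1 b2]; split; rewrite starM.
  by rewrite mulrA -(mulrA (star b)) a1 mulr1.
by rewrite mulrA -(mulrA a) b2 mulr1.
Qed.

Variables (H : hilbertType R) (Psi : A -> H -> H).
Hypothesis PsiR : unital_star_repr setT Psi.

Lemma repr_linear a : linear (Psi a).
Proof. by have [bd _ _ _ _] := PsiR; have [] := bd a Logic.I. Qed.

Lemma repr_semilinear (c : R[i]) a b x : Psi (c *: a + b) x = c *: Psi a x + Psi b x.
Proof. by have [_ lin _ _ _] := PsiR; exact: lin. Qed.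

Lemma reprM a b x : Psi (a * b) x = Psi a (Psi b x).
Proof. by have [_ _ mul _ _] := PsiR; exact: mul. Qed.

Lemma repr1 x : Psi 1 x = x.
Proof. by have [_ _ _ one _] := PsiR. Qed.

Lemma repr_star a x y : hdot (Psi (star a) x) y = hdot x (Psi a y).
Proof. by have [_ _ _ _ adj] := PsiR; exact: adj. Qed.

Lemma repr_bounded a : exists2 M : R[i], 0 < M & forall x, `|Psi a x| <= M * `|x|.
Proof.
have [bd _ _ _ _] := PsiR; have [_ [M Mx]] := bd a Logic.I.
(* [bounded_operator] allows any [M] in [R[i]]. As [M * |x|] is nonnegative it equals [|M| * |x|],
   and adding 1 makes the bound positive. *)
exists (`|M| + 1); first by rewrite ltr_wpDl.
move=> x; apply: (@le_trans _ _ (`|M| * `|x|)); last by rewrite ler_wpM2r// lerDl.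
have Mx0 : 0 <= M * `|x| by apply: (le_trans _ (Mx x)).
by rewrite -[X in _ * X]normr_id -normrM ger0_norm.
Qed.

Lemma reprX_bounded a : exists2 M : R[i], 0 < M &
  forall n x, `|Psi (a ^+ n) x| <= M ^+ n * `|x|.
Proof.
have [M M0 Mx] := repr_bounded a; exists M => // n.
elim: n => [|n IH] x; first by rewrite !expr0 repr1 mul1r.
rewrite exprS reprM (le_trans (Mx _))// exprS -mulrA ler_pM2l//.
Qed.

Lemma unitary_isometric a x : unitary a -> `|Psi a x| = `|x|.
Proof.
move=> [aa _]; apply/eqP; rewrite -(@eqrXn2 _ 2)//; apply/eqP.
by rewrite !sqr_norm_hdot -repr_star -reprM aa repr1.
Qed.

End Unitary.

Section LinearMaps.
Variables (R : realType) (U W : lmodType R[i]) (f : U -> W).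
Hypothesis fL : linear f.

Lemma linear_map0 : f 0 = 0.
Proof. by have := fL (-1) 0 0; rewrite scaler0 addr0 scaleN1r addNr. Qed.

Lemma linear_mapZ (c : R[i]) u : f (c *: u) = c *: f u.
Proof. by rewrite -[c *: u]addr0 fL linear_map0 addr0. Qed.

Lemma linear_mapD u v : f (u + v) = f u + f v.
Proof. by rewrite -[u]scale1r fL !scale1r. Qed.

Lemma linear_map_sum n (c : 'I_n -> R[i]) (s : 'I_n -> U) :
  f (\sum_(k < n) c k *: s k) = \sum_(k < n) c k *: f (s k).
Proof.
elim/big_ind2 : _ => [|u u' v v' <- <-|k _]; first exact: linear_map0.
  exact: linear_mapD.
exact: linear_mapZ.
Qed.

End LinearMaps.

(** * Cofinite equality and its classes *)

Section CofinEq.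
Variables (R : realType) (I : eqType) (X : I -> lmodType R[i]).
Implicit Types x y z : forall i, X i.

Lemma cofin_eq_refl x : cofin_eq x x.
Proof. exact: almost_allT. Qed.

Lemma cofin_eq_sym x y : cofin_eq x y -> cofin_eq y x.
Proof. exact: almost_all_sub. Qed.

Lemma cofin_eq_trans x y z : cofin_eq x y -> cofin_eq y z -> cofin_eq x z.
Proof.
move=> xy yz; apply: almost_all_sub (almost_all_and xy yz) => i [-> ->] //.
Qed.

Lemma dfwith_eta x i : dfwith x i (x i) = x.
Proof.
apply: functional_extensionality_dep => k.
by case: (eqVneq i k) => [<-|ik]; [rewrite dfwithin|rewrite dfwithout].
Qed.

Variable D : forall i, set (X i).

Definition cofin_class (u : forall i, X i) (Du : forall i, @D i (u i)) :
    cofin_classes D :=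
  exist _ [set x | (forall i, @D i (x i)) /\ cofin_eq x u]
    (ex_intro2 _ _ u Du erefl).

Lemma cofin_class_rep (w : cofin_classes D) : exists2 u, (forall i, @D i (u i)) &
  sval w = [set x | (forall i, @D i (x i)) /\ cofin_eq x u].
Proof. by case: w. Qed.

Lemma tensor_classE (T : lmodType R[i]) (theta : (forall i, X i) -> T)
    (w : cofin_classes D) (u : forall i, X i) : sval w u ->
  tensor_class theta w = tensor_at theta u.
Proof.
have [v Dv wE] := cofin_class_rep w; rewrite wE => -[Du uv].
rewrite /tensor_class /tensor_at; congr lspan; apply/seteqP; split.
  move=> t [y] /=; rewrite wE => -[_ yv] [x xy <-]; exists x => //.
  exact: (cofin_eq_trans xy (cofin_eq_trans yv (cofin_eq_sym uv))).
by move=> t [x xu xt]; exists u; [rewrite wE|exists x].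
Qed.

Lemma cofin_class_inhab (w : cofin_classes D) :
  exists2 u, (forall i, @D i (u i)) & sval w u.
Proof.
have [u Du wE] := cofin_class_rep w; exists u => //.
by rewrite wE; split => //; exact: cofin_eq_refl.
Qed.

Lemma cofin_class_eq (w w' : cofin_classes D) u u' :
  sval w u -> sval w' u' -> cofin_eq u u' -> w = w'.
Proof.
have [v Dv wE] := cofin_class_rep w; have [v' Dv' wE'] := cofin_class_rep w'.
move=> wu wu' uu'; suff ww' : sval w = sval w'.
  by case: w w' ww' {wE wE' wu wu'} => w wP [w' w'P] /= ww'; exact: eq_exist.
move: wu wu'; rewrite wE wE' => -[_ uv] [_ uv'].
apply/seteqP; split=> x [Dx xv]; split => //.
  exact: (cofin_eq_trans xv (cofin_eq_trans (cofin_eq_sym uv) (cofin_eq_trans uu' uv'))).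
apply: (cofin_eq_trans xv (cofin_eq_trans (cofin_eq_sym uv') _)).
exact: (cofin_eq_trans (cofin_eq_sym uu') uv).
Qed.

End CofinEq.

(** * Algebra of the tensor product operators and their invariant subspaces *)

Section TensorOperators.
Variables (R : realType) (I : choiceType).
Variables (A : I -> starAlgType R) (H : I -> hilbertType R).
Variables (Psi : forall i, A i -> H i -> H i).
Arguments Psi : clear implicits.
Variables (TA : starAlgType R) (thA : (forall i, A i) -> TA).
Variables (TH : lmodType R[i]) (thH : (forall i, H i) -> TH).
Hypothesis H_nonzero : forall i, exists x : H i, x != 0.
Hypothesis PsiR : forall i, unital_star_repr [set: A i] (Psi i).
Hypothesis thA_tensor : is_tensor_star_algebra thA.
Hypothesis thH_tensor : is_tensor_product thH.

Local Notation op := (tensor_op thH thA Psi).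

Let tA : is_tensor_product thA. Proof. by case: thA_tensor. Qed.

Let opE a x : op (thA a) (thH x) = thH (fun i => Psi i (a i) (x i)).
Proof. exact: tensor_opE. Qed.

Lemma tensor_op_linearl (c : R[i]) a b s : op (c *: a + b) s = c *: op a s + op b s.
Proof. by rewrite /tensor_op tensor_lift_linear. Qed.

Let opl s : linear (op ^~ s). Proof. by move=> c a b; exact: tensor_op_linearl. Qed.

Lemma tensor_op_linear a : linear (op a).
Proof.
(* On an elementary tensor the outer lift is either an inner lift or its default value 0, both
   linear; linearity in [a] then covers all of [TA]. *)
have opth b : linear (op (thA b)).
  rewrite /tensor_op {1}/tensor_lift; case: pselect => [h|_] c s t.
    by case: cid => g gE /=; rewrite gE tensor_lift_linear.
  by rewrite /= -[RHS]/(c *: (0 : TH) + 0) scaler0 addr0.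
move=> c s t; move: a; apply: (tensor_ext tA (opl _)).
  move=> d a b; rewrite !opl !scalerDr addrACA; congr (_ + _ + _).
  by rewrite !scalerA mulrC.
by move=> b; exact: opth.
Qed.

(** Both sides are linear in each of [a], [b] and [s], so [tensor_ext] leaves elementary tensors,
    where [reprM] applies at each coordinate. *)
Lemma tensor_opM a b s : op (a * b) s = op a (op b s).
Proof.
have [_ thM _ _] := thA_tensor.
have opMl (t : TA) s' : linear (fun a => op (a * t) s').
  by move=> c u v; rewrite mulrDl -scalerAl opl.
have opMr (t : TA) s' : linear (fun a => op (t * a) s').
  by move=> c u v; rewrite mulrDr -scalerAr opl.
have opopr (t : TA) s' : linear (fun a => op t (op a s')).
  by move=> c u v; rewrite opl tensor_op_linear.
move: a; apply: (tensor_ext tA (opMl _ _) (opl _)) => a.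
move: b; apply: (tensor_ext tA (opMr _ _) (opopr _ _)) => b.
move: s; apply: (tensor_ext thH_tensor); first exact: tensor_op_linear.
  by move=> c u v; rewrite !tensor_op_linear.
move=> x; rewrite -thM !opE; congr thH.
by apply: functional_extensionality_dep => i; rewrite reprM.
Qed.

Lemma tensor_op1 s : op 1 s = s.
Proof.
have [_ _ th1 _] := thA_tensor; move: s.
apply: (tensor_ext thH_tensor) => //; first exact: tensor_op_linear.
move=> x; rewrite -th1 opE; congr thH.
by apply: functional_extensionality_dep => i; rewrite repr1.
Qed.

Definition almost_unitary (a : forall i, A i) : Prop :=
  almost_all (fun i => unitary (a i)).

(** A family unitary at almost all coordinates is in relation ~ with the family of unitaries that
    has 1 at the remaining ones. This replaces the classes by explicit generators. *)
Lemma tensor_utE : tensor_ut thA = lspan [set thA a | a in almost_unitary].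
Proof.
apply/seteqP; split; apply: lspan_sub.
  move=> t [w _]; have [u Uu wu] := cofin_class_inhab w.
  rewrite (tensor_classE _ wu); apply: lspan_sub => _ [a au <-].
  by apply: lspan_gen; exists a => //; apply: almost_all_sub au => i ->.
move=> _ [a aU <-]; apply: lspan_gen.
pose u i := if `[< unitary (a i) >] then a i else 1.
have Uu i : unitary (u i).
  by rewrite /u; case: asboolP => // _; exact: unitary1.
exists (cofin_class Uu) => //; rewrite (@tensor_classE _ _ _ _ _ _ _ u).
  apply: lspan_gen; exists a => //; apply: almost_all_sub aU => i Ui.
  by rewrite /u asboolT.
by split => //; exact: cofin_eq_refl.
Qed.

Lemma tensor_ut_th a : almost_unitary a -> tensor_ut thA (thA a).
Proof. by move=> aU; rewrite tensor_utE; apply: lspan_gen; exists a. Qed.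

Lemma tensor_utM a b : tensor_ut thA a -> tensor_ut thA b -> tensor_ut thA (a * b).
Proof.
have [_ thM _ _] := thA_tensor; rewrite tensor_utE => + bU; move: a.
apply: lspan_ind; first by rewrite mul0r; exact: lspan0.
move=> c _ v [a aU <-] _ IH; rewrite mulrDl -scalerAl; apply: lspan_linear => //.
move: b bU {IH}; apply: lspan_ind; first by rewrite mulr0; exact: lspan0.
move=> d _ w [b bU <-] _ IH; rewrite mulrDr -scalerAr; apply: lspan_linear => //.
rewrite -thM; apply: lspan_gen; exists (fun i => a i * b i) => //.
by apply: almost_all_sub (almost_all_and aU bU) => i [] /unitaryM; apply.
Qed.

Lemma almost_unitary_star a : almost_unitary a -> almost_unitary (fun i => star (a i)).
Proof. by apply: almost_all_sub => i; exact: unitary_star. Qed.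

Lemma tensor_ut_star a : tensor_ut thA a -> tensor_ut thA (star a).
Proof.
have [_ _ _ thS] := thA_tensor; rewrite tensor_utE; move: a.
apply: lspan_ind; first by rewrite star0; exact: lspan0.
move=> c _ v [a aU <-] _ IH; rewrite star_semilinear; apply: lspan_linear => //.
rewrite -thS; apply: lspan_gen; exists (fun i => star (a i)) => //.
exact: almost_unitary_star.
Qed.

Lemma tensor_ut1 : tensor_ut thA 1.
Proof.
have [_ _ <- _] := thA_tensor; apply: tensor_ut_th.
by apply: almost_allT => i; exact: unitary1.
Qed.

Lemma tensor_e_ut : tensor_e thA `<=` tensor_ut thA.
Proof.
rewrite tensor_utE; apply: lspan_sub => _ [a a1 <-]; apply: lspan_gen.
by exists a => //; apply: almost_all_sub a1 => i ->; exact: unitary1.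
Qed.

Definition almost_unit (x : forall i, H i) : Prop :=
  almost_all (fun i => unit_sphere (x i)).

(** Multilinearity takes a scalar out of each of the finitely many bad coordinates in turn; for a
    zero coordinate [H_nonzero] supplies the unit vector. Needed because the tensor of an almost
    unitary family maps unit families only to almost unit ones. *)
Lemma tensor_un_almost x : almost_unit x -> tensor_un thH (thH x).
Proof.
move=> /almost_all_seqP[s]; elim: s x => [|i s IH] x xu.
  by apply: lspan_gen; exists x => // i; exact: xu.
have [c [e [eu xce]]] := scaled_unit_vector (x i) (H_nonzero i).
have thL : linear (fun v => thH (dfwith x i v)) by exact: thH_tensor.1.
rewrite -(dfwith_eta x i) xce (linear_mapZ thL); apply: lspanZ; apply: IH.
move=> k ks; case: (eqVneq i k) => [<-|ik]; first by rewrite dfwithin.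
by rewrite dfwithout//; apply: xu; rewrite in_cons negb_or eq_sym ik.
Qed.

Lemma tensor_class_un (mu : cofin_classes (fun i => @unit_sphere R (H i))) :
  tensor_class thH mu `<=` tensor_un thH.
Proof.
have [u Uu mu_u] := cofin_class_inhab mu; rewrite (tensor_classE _ mu_u).
apply: lspan_sub => _ [x xu <-]; apply: tensor_un_almost.
by apply: almost_all_sub xu => i ->.
Qed.

Lemma almost_unit_op a x : almost_unitary a -> almost_unit x ->
  almost_unit (fun i => Psi i (a i) (x i)).
Proof.
move=> aU xU; apply: almost_all_sub (almost_all_and aU xU) => i [Ui xi].
by rewrite /unit_sphere /= unitary_isometric.
Qed.

Lemma tensor_un_op a s :
  tensor_ut thA a -> tensor_un thH s -> tensor_un thH (op a s).
Proof.
move=> aU; move: s; apply: lspan_ind.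
  by rewrite (linear_map0 (tensor_op_linear a)); exact: lspan0.
move=> c _ s [x xu <-] _ IH; rewrite tensor_op_linear; apply: lspan_linear => //.
move: a aU {IH}; rewrite tensor_utE; apply: lspan_ind.
  by rewrite (linear_map0 (opl _)); exact: lspan0.
move=> d _ t [a aU <-] _ IH; rewrite opl; apply: lspan_linear => //.
rewrite opE; apply/tensor_un_almost/almost_unit_op => //; exact: almost_allT.
Qed.

(** Elementary tensors in [tensor_e] act as the identity at almost all coordinates, whereas those in
    [tensor_ut] may move one class into another. *)
Lemma tensor_class_op (mu : cofin_classes (fun i => @unit_sphere R (H i))) a s :
  tensor_e thA a -> tensor_class thH mu s -> tensor_class thH mu (op a s).
Proof.
have [u Uu mu_u] := cofin_class_inhab mu; rewrite (tensor_classE _ mu_u).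
move=> aU; move: s; apply: lspan_ind.
  by rewrite (linear_map0 (tensor_op_linear a)); exact: lspan0.
move=> c _ s [x xu <-] _ IH; rewrite tensor_op_linear; apply: lspan_linear => //.
move: a aU {IH}; apply: lspan_ind.
  by rewrite (linear_map0 (opl _)); exact: lspan0.
move=> d _ t [a aU <-] _ IH; rewrite opl; apply: lspan_linear => //.
rewrite opE; apply: lspan_gen; exists (fun i => Psi i (a i) (x i)) => //.
by apply: almost_all_sub (almost_all_and aU xu) => i [-> ->]; rewrite repr1.
Qed.

End TensorOperators.

(** * Extension of bounded linear maps to a completion *)

Section CompletionExtension.
Variables (R : realType) (T : lmodType R[i]) (V : set T).
Variables (ip : T -> T -> R[i]) (K L : hilbertType R) (j : T -> K) (g : T -> L).
Hypothesis VL : forall (c : R[i]) u v, V u -> V v -> V (c *: u + v).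
Hypothesis jC : is_completion V ip j.

(** By linearity the bound at [v - w] is the Lipschitz condition relative to [j] that extension by
    continuity requires. *)
Lemma continuous_ext_bounded (M : R[i]) : 0 <= M ->
  (forall (c : R[i]) u v, V u -> V v -> g (c *: u + v) = c *: g u + g v) ->
  (forall v, V v -> `|g v| <= M * `|j v|) ->
  [/\ lipschitz_map (continuous_ext V j g), linear (continuous_ext V j g) &
      forall v, V v -> continuous_ext V j g (j v) = g v].
Proof.
have [jL _ jdense] := jC; move=> M0 gL gM.
have gB v w : V v -> V w -> `|g v - g w| <= M * `|j v - j w|.
  move=> Vv Vw; have := gM _ (VL (-1) Vw Vv).
  by rewrite gL// jL// !scaleN1r ![- _ + _]addrC.
split; first exact: (lipschitz_continuous_ext jdense M0 gB).
  exact: (linear_continuous_ext jdense M0 gB VL jL gL).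
move=> v Vv; exact: (continuous_extE jdense M0 gB Vv).
Qed.

Lemma completion0 v : V v -> j 0 = 0.
Proof.
have [jL _ _] := jC; move=> Vv; have V0 : V 0 by rewrite -(addNr v) -scaleN1r; exact: VL.
by have := jL (-1) 0 0 V0 V0; rewrite scaler0 addr0 scaleN1r addNr.
Qed.

End CompletionExtension.

Section LipschitzLinear.
Variables (R : realType) (K : hilbertType R) (f : K -> K).

Lemma lipschitz_linear_bounded :
  linear f -> lipschitz_map f -> bounded_operator f.
Proof.
move=> fL [M M0 fM]; split => //; exists M => x.
by have := fM x 0; rewrite (linear_map0 fL) !subr0.
Qed.

End LipschitzLinear.

(** * Norms of elementary tensors *)

Section Phi1.
Variables (R : realType) (I : choiceType) (H : I -> hilbertType R).
Implicit Types x y : forall i, H i.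

Lemma eq_phi1 x y x' y' :
  (forall i, hdot (x i) (y i) = hdot (x' i) (y' i)) -> phi1 x y = phi1 x' y'.
Proof.
move=> xy.
have E : (fun i => hdot (x i) (y i)) = (fun i => hdot (x' i) (y' i)).
  by apply/funext => i; exact: xy.
have E1 : (fun i => hdot (x i) (y i) = 1) = (fun i => hdot (x' i) (y' i) = 1).
  by apply/funext => i; rewrite xy.
rewrite /phi1 E E1; case: ifP => // _; apply: eq_bigr => i _; exact: xy.
Qed.

Lemma phi1_norm_le (s : seq I) (m : I -> R[i]) y : uniq s ->
  (forall i, i \notin s -> unit_sphere (y i)) -> (forall i, `|y i| <= m i) ->
  phi1 y y <= \prod_(i <- s) m i ^+ 2.
Proof.
move=> us ys ym; rewrite /phi1 asboolT; last first.
  by apply/almost_all_seqP; exists s => i /ys; exact: unit_vector_inner.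
rewrite -(fsbig_widen [set` s] setT) //; last first.
  by move=> i [_ /negP /ys] yi /=; exact: unit_vector_inner.
rewrite -fsbig_seq//; apply: ler_prod => i _.
by rewrite -sqr_norm_hdot exprn_ge0//= lerXn2r ?nnegrE// (le_trans _ (ym i)).
Qed.

End Phi1.

Lemma starX (R : realType) (A : starAlgType R) (a : A) n : star (a ^+ n) = star a ^+ n.
Proof. by elim: n => [|n IH]; rewrite ?expr0 ?star1// exprS starM IH exprSr. Qed.

(** * Boundedness of the operators and the representation on the completion, part (a) *)

Section Boundedness.
Variables (R : realType) (I : choiceType).
Variables (A : I -> starAlgType R) (H : I -> hilbertType R).
Variables (Psi : forall i, A i -> H i -> H i).
Arguments Psi : clear implicits.
Variables (TA : starAlgType R) (thA : (forall i, A i) -> TA).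
Variables (TH : lmodType R[i]) (thH : (forall i, H i) -> TH).
Variables (K : hilbertType R) (j : TH -> K).
Hypothesis H_nonzero : forall i, exists x : H i, x != 0.
Hypothesis PsiR : forall i, unital_star_repr [set: A i] (Psi i).
Hypothesis thA_tensor : is_tensor_star_algebra thA.
Hypothesis thH_tensor : is_tensor_product thH.
Hypothesis jC : is_completion (tensor_un thH) (phi1_ip thH) j.

Local Notation op := (tensor_op thH thA Psi).
Local Notation V := (tensor_un thH).

Let tA : is_tensor_product thA. Proof. by case: thA_tensor. Qed.
Let opE a x : op (thA a) (thH x) = thH (fun i => Psi i (a i) (x i)).
Proof. exact: tensor_opE. Qed.
Let opl c a b s : op (c *: a + b) s = c *: op a s + op b s.
Proof. exact: tensor_op_linearl. Qed.
Let opr a : linear (op a). Proof. exact: tensor_op_linear. Qed.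
Let Vop a s : tensor_ut thA a -> V s -> V (op a s).
Proof. exact: tensor_un_op. Qed.
Let VL (c : R[i]) u v : V u -> V v -> V (c *: u + v).
Proof. exact: lspan_linear. Qed.
Let V0 : V 0. Proof. exact: lspan0. Qed.
Let jL (c : R[i]) u v : V u -> V v -> j (c *: u + v) = c *: j u + j v.
Proof. by case: jC => + _ _; apply. Qed.
Let j0 : j 0 = 0. Proof. exact: (completion0 VL jC V0). Qed.
Let Vun x : (forall i, unit_sphere (x i)) -> V (thH x).
Proof. by move=> xu; apply: lspan_gen; exists x. Qed.
Let jopl (c : R[i]) a b s : tensor_ut thA a -> tensor_ut thA b -> V s ->
  j (op (c *: a + b) s) = c *: j (op a s) + j (op b s).
Proof. by move=> aU bU Vs; rewrite opl jL//; exact: Vop. Qed.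
Let jopr (c : R[i]) a s t : tensor_ut thA a -> V s -> V t ->
  j (op a (c *: s + t)) = c *: j (op a s) + j (op a t).
Proof. by move=> aU Vs Vt; rewrite opr jL//; exact: Vop. Qed.

Lemma completion_phi1 x y : almost_unit x -> almost_unit y ->
  hdot (j (thH x)) (j (thH y)) = phi1 x y.
Proof.
have [_ jip _] := jC; move=> xu yu.
by rewrite jip ?phi1_ipE//; exact: tensor_un_almost.
Qed.

(** Expanding [a], [s] and [t] in turn leaves elementary tensors, for which the two values of [phi1]
    have equal factors by [repr_star]. *)
Lemma tensor_op_adjoint a s t : tensor_ut thA a -> V s -> V t ->
  hdot (j (op (star a) s)) (j t) = hdot (j s) (j (op a t)).
Proof.
have [_ _ _ thS] := thA_tensor.
have op0 s' : op 0 s' = 0.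
  exact: (linear_map0 (f := op ^~ s') (fun c a b => opl c a b s')).
have utL : tensor_ut thA = lspan [set thA a | a in @almost_unitary _ _ _].
  exact: tensor_utE.
rewrite utL => + Vs Vt; move: a; apply: lspan_ind.
  by rewrite star0 !op0 j0 linear0l linear0r.
move=> c _ v [a aU <-]; rewrite -utL => vut IH.
have aut : tensor_ut thA (thA a) by exact: tensor_ut_th.
have asut : tensor_ut thA (star (thA a)) by exact: tensor_ut_star.
have vsut : tensor_ut thA (star v) by exact: tensor_ut_star.
rewrite star_semilinear !jopl// !hdotDl hdotZl hdotDr hdotZr IH.
congr (_ * _ + _) => {v vut vsut IH c}.
move: s Vs; apply: lspan_ind; first by rewrite (linear_map0 (opr _)) j0 !linear0l.
move=> c _ v [x xu <-] Vv IH; have Vx := Vun xu; rewrite jopr// jL// !hdotDl !hdotZl IH.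
congr (_ * _ + _) => {v Vv IH c}.
move: t Vt; apply: lspan_ind; first by rewrite (linear_map0 (opr _)) j0 !linear0r.
move=> c _ v [y yu <-] Vv IH; have Vy := Vun yu; rewrite jopr// jL// !hdotDr !hdotZr IH.
congr (_ * _ + _); rewrite -thS !opE.
have xa : almost_unit x by exact: almost_allT.
have ya : almost_unit y by exact: almost_allT.
rewrite !completion_phi1//.
- by apply: eq_phi1 => i; rewrite (repr_star (PsiR i)).
- exact: almost_unit_op.
- apply: almost_unit_op => //; exact: almost_unitary_star.
Qed.

(** [Q] is the product, over a finite list containing all coordinates where [a] is not unitary, of
    bounds for the powers of [star (a i) * a i]; elsewhere these powers are 1. The triangle
    inequality over the terms of [s] only enlarges [c], which may depend on [s]. *)
Lemma tensor_op_power_growth (a : forall i, A i) : almost_unitary a ->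
  exists2 Q : R[i], 0 < Q & forall s, V s -> exists2 c : R[i], 0 <= c &
    forall n, `|j (op (thA (fun i => (star (a i) * a i) ^+ n)) s)| <= c * Q ^+ n.
Proof.
move=> aU; have /almost_all_seqP[r0 r0U] := aU.
pose r := undup r0.
have rU i : i \notin r -> unitary (a i) by rewrite mem_undup; exact: r0U.
have /choice[M MP] i : exists M : R[i], 0 < M /\
    forall n x, `|Psi i ((star (a i) * a i) ^+ n) x| <= M ^+ n * `|x|.
  by have [M M0 MP] := reprX_bounded (PsiR i) (star (a i) * a i); exists M.
have Q0 : 0 < \prod_(i <- r) M i by apply: prodr_gt0 => i _; case: (MP i).
have bU n : almost_unitary (fun i => (star (a i) * a i) ^+ n).
  apply: almost_all_sub aU => i [-> _]; rewrite expr1n; exact: unitary1.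
exists (\prod_(i <- r) M i) => //; apply: lspan_ind.
  by exists 0 => // n; rewrite (linear_map0 (opr _)) j0 normr0 mul0r.
move=> c _ s [x xu <-] Vs [d d0 IH]; exists (`|c| + d); first exact: addr_ge0.
move=> n; have Vx := Vun xu; have bn := tensor_ut_th thA (bU n); rewrite jopr//.
rewrite (le_trans (ler_normD _ _))// mulrDl lerD// normrZ ler_wpM2l//.
(* The squared norm of an elementary tensor is a value of [phi1], here a finite product that is
   compared factor by factor with the square of [Q ^+ n]. *)
rewrite -(@ler_pXn2r _ 2) ?nnegrE ?exprn_ge0 ?(ltW Q0)//.
have xa : almost_unit x by exact: almost_allT.
rewrite sqr_norm_hdot opE completion_phi1; try exact: almost_unit_op.
rewrite -exprM mulnC exprM -prodrXl -prodrXl.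
rewrite (eq_bigr (fun i => (M i ^+ n) ^+ 2)); last by move=> i _; rewrite -!exprM mulnC.
apply: phi1_norm_le; first exact: undup_uniq.
  by move=> i /rU[-> _]; rewrite expr1n repr1.
by move=> i; have [_ /(_ n (x i))] := MP i; rewrite xu mulr1.
Qed.

Lemma tensor_op_elementary_bounded (a : forall i, A i) : almost_unitary a ->
  exists2 M : R[i], 0 <= M & forall s, V s -> `|j (op (thA a) s)| <= M * `|j s|.
Proof.
move=> aU; have [_ thM _ thS] := thA_tensor.
have [Q Q0 growth] := tensor_op_power_growth aU.
pose b n := thA (fun i => (star (a i) * a i) ^+ n).
have but n : tensor_ut thA (b n).
  apply: tensor_ut_th; apply: almost_all_sub aU => i [-> _].
  by rewrite expr1n; exact: unitary1.
have aut : tensor_ut thA (thA a) by exact: tensor_ut_th.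
have bD n m s : op (b n) (op (b m) s) = op (b (n + m)%N) s.
  rewrite -tensor_opM// -thM; congr (op (thA _) s).
  by apply: functional_extensionality_dep => i; rewrite exprD.
have bS n : star (b n) = b n.
  rewrite -thS; congr thA; apply: functional_extensionality_dep => i.
  by rewrite starX starM starK.
have b0 s : op (b 0%N) s = s.
  rewrite (_ : b 0%N = 1) ?tensor_op1//.
  by have [_ _ <- _] := thA_tensor; congr thA.
(* [Q + 1] stands in for the square root of [Q], since [Q <= (Q + 1) ^+ 2]. *)
exists (Q + 1); first by rewrite addr_ge0// ltW.
move=> s Vs; have [c c0 sc] := growth s Vs.
have Vb n : V (op (b n) s) by exact: Vop.
have Va : V (op (thA a) s) by exact: Vop.
pose p n := `|j (op (b n) s)|.
have p1 : p 1%N <= Q * p 0%N.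
  apply: (doubling_growth_boundC Q0 c0) => // n; rewrite /p ?normr_ge0//.
  (* Doubling: [b n] is self-adjoint, so [p n ^+ 2] is the inner product of [b (2 n) s] with [s], to
     which Cauchy-Schwarz applies. *)
  rewrite sqr_norm_hdot -tensor_op_adjoint// bS bD addnn b0.
  rewrite -[leLHS]ger0_norm; first exact: norm_hdot_le.
  by rewrite -addnn -bD -{1}bS tensor_op_adjoint// -sqr_norm_hdot exprn_ge0.
rewrite -(@ler_pXn2r _ 2) ?nnegrE ?mulr_ge0 ?addr_ge0 ?(ltW Q0)//.
rewrite sqr_norm_hdot -tensor_op_adjoint// -tensor_opM//.
have -> : star (thA a) * thA a = b 1%N.
  by rewrite -thS -thM; congr thA.
rewrite -[leLHS]ger0_norm; last first.
  have -> : b 1%N = star (thA a) * thA a by rewrite -thS -thM; congr thA.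
  by rewrite tensor_opM// tensor_op_adjoint// -sqr_norm_hdot exprn_ge0.
rewrite (le_trans (norm_hdot_le _ _))// -/(p 1%N).
move: p1; rewrite /p b0 => p1; rewrite (le_trans (ler_wpM2r _ p1))// exprMn -mulrA -expr2.
rewrite ler_wpM2r ?exprn_ge0// -subr_ge0.
have -> : (Q + 1) ^+ 2 - Q = Q ^+ 2 + Q + 1 by ring.
by rewrite !addr_ge0 ?exprn_ge0 ?(ltW Q0).
Qed.

Lemma tensor_op_bounded a : tensor_ut thA a ->
  exists2 M : R[i], 0 <= M & forall s, V s -> `|j (op a s)| <= M * `|j s|.
Proof.
have utL : tensor_ut thA = lspan [set thA a | a in @almost_unitary _ _ _].
  exact: tensor_utE.
rewrite utL; move: a; apply: lspan_ind.
  exists 0 => // s _; rewrite (linear_map0 (f := op ^~ s)) ?j0 ?normr0 ?mul0r//.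
  by move=> c a b; exact: opl.
move=> c _ a [b bU <-]; rewrite -utL => aut [N N0 aN].
have [M M0 bM] := tensor_op_elementary_bounded bU.
exists (`|c| * M + N); first by rewrite addr_ge0 ?mulr_ge0.
have but := tensor_ut_th thA bU.
move=> s Vs; rewrite jopl// (le_trans (ler_normD _ _))// mulrDl lerD//; last exact: aN.
by rewrite normrZ -mulrA ler_wpM2l// bM.
Qed.

Local Notation Pi := (tensor_repr thH thA Psi V j).

Lemma tensor_repr_unP a : tensor_ut thA a ->
  [/\ lipschitz_map (Pi a), linear (Pi a) &
      forall s, V s -> Pi a (j s) = j (op a s)].
Proof.
move=> aut; have [M M0 aM] := tensor_op_bounded aut.
by apply: (continuous_ext_bounded VL jC M0) => // c u v Vu Vv /=; exact: jopr.
Qed.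

(** Each identity holds for [op] on the dense subspace and has Lipschitz sides. The adjoint relation
    takes two density arguments, in [x] and then, after conjugation, in [y]. *)
Lemma tensor_repr_unital_star : unital_star_repr (tensor_ut thA) Pi.
Proof.
have [_ _ jdense] := jC.
have ut_lin (c : R[i]) a b : tensor_ut thA a -> tensor_ut thA b ->
    tensor_ut thA (c *: a + b) by rewrite tensor_utE; exact: lspan_linear.
split.
- move=> a /tensor_repr_unP[lip lin _]; exact: lipschitz_linear_bounded.
- move=> c a b aU bU; have [la _ aE] := tensor_repr_unP aU.
  have [lb _ bE] := tensor_repr_unP bU.
  have [lab _ abE] := tensor_repr_unP (ut_lin c a b aU bU).
  apply: (dense_lipschitz_eq jdense) => //.
    by apply: lipschitz_mapD => //; exact: lipschitz_mapZ.
  by move=> _ [s Vs <-]; rewrite abE// aE// bE// jopl.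
- move=> a b aU bU; have [la _ aE] := tensor_repr_unP aU.
  have [lb _ bE] := tensor_repr_unP bU.
  have [lab _ abE] := tensor_repr_unP (tensor_utM thA_tensor aU bU).
  apply: (dense_lipschitz_eq jdense) => //; first exact: (lipschitz_map_comp la lb).
  move=> _ [s Vs <-] /=; have Vbs := Vop bU Vs.
  by rewrite abE// bE// aE// tensor_opM.
- have [l1 _ E1] := tensor_repr_unP (tensor_ut1 thA_tensor).
  apply: (dense_lipschitz_eq jdense l1 (@lipschitz_map_id _ K)).
  by move=> _ [s Vs <-]; rewrite E1// tensor_op1.
- move=> a aU; have [la _ aE] := tensor_repr_unP aU.
  have [ls _ sE] := tensor_repr_unP (tensor_ut_star thA_tensor aU).
  move=> x y; move: x; apply: (dense_lipschitz_eq (L := R[i]^o) jdense).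
  + exact: (lipschitz_map_comp (lipschitz_hdotl y) ls).
  + exact: lipschitz_hdotl.
  move=> _ [s Vs <-]; apply: (can_inj conjCK).
  move: y; apply: (dense_lipschitz_eq (L := R[i]^o) jdense).
  + exact: lipschitz_hdotr.
  + exact: (lipschitz_map_comp (lipschitz_hdotr (j s)) la).
  move=> _ [t Vt <-]; rewrite /= sE// aE//; congr Num.conj.
  exact: tensor_op_adjoint.
Qed.

End Boundedness.

(** * Decomposition over the classes of unit families, part (b) *)

Section DirectSum.
Variables (R : realType) (I : choiceType).
Variables (A : I -> starAlgType R) (H : I -> hilbertType R).
Variables (Psi : forall i, A i -> H i -> H i).
Arguments Psi : clear implicits.
Variables (TA : starAlgType R) (thA : (forall i, A i) -> TA).
Variables (TH : lmodType R[i]) (thH : (forall i, H i) -> TH).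
Variables (K : hilbertType R) (j : TH -> K).
Local Notation classes := (cofin_classes (fun i => @unit_sphere R (H i))).
Variable (Kmu : classes -> hilbertType R).
Variable (jmu : forall mu, TH -> Kmu mu).
Hypothesis H_nonzero : forall i, exists x : H i, x != 0.
Hypothesis PsiR : forall i, unital_star_repr [set: A i] (Psi i).
Hypothesis thA_tensor : is_tensor_star_algebra thA.
Hypothesis thH_tensor : is_tensor_product thH.
Hypothesis jC : is_completion (tensor_un thH) (phi1_ip thH) j.
Hypothesis jmuC : forall mu,
  is_completion (tensor_class thH mu) (phi1_ip thH) (jmu mu).

Local Notation op := (tensor_op thH thA Psi).
Local Notation V := (tensor_un thH).
Local Notation Vmu := (tensor_class thH).
Local Notation incl mu := (continuous_ext (Vmu mu) (jmu mu) j).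

Let VmuL (mu : classes) (c : R[i]) u v : Vmu mu u -> Vmu mu v -> Vmu mu (c *: u + v).
Proof. exact: lspan_linear. Qed.

Let VmuV (mu : classes) s : Vmu mu s -> V s.
Proof. exact: tensor_class_un. Qed.

Let hdot_jmu (mu : classes) u v : Vmu mu u -> Vmu mu v ->
  hdot (jmu mu u) (jmu mu v) = hdot (j u) (j v).
Proof.
have [_ jip _] := jC; have [_ jmuip _] := jmuC mu.
by move=> Vu Vv; rewrite jmuip// jip//; [exact: VmuV Vu|exact: VmuV Vv].
Qed.

Let norm_jmu (mu : classes) u : Vmu mu u -> `|jmu mu u| = `|j u|.
Proof.
move=> Vu; apply/eqP; rewrite -(@eqrXn2 _ 2)//; apply/eqP.
by rewrite !sqr_norm_hdot hdot_jmu.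
Qed.

(** Both completions restrict to the same form on the class subspace, so [jmu mu v] and [j v] have
    equal norms and the constant 1 suffices. *)
Lemma inclP mu : [/\ lipschitz_map (incl mu), linear (incl mu) &
  forall v, Vmu mu v -> incl mu (jmu mu v) = j v].
Proof.
have [jL _ _] := jC; apply: (continuous_ext_bounded (VmuL (mu := mu)) (jmuC mu) ler01).
  by move=> c u v /VmuV Vu /VmuV Vv; exact: jL.
by move=> v Vv; rewrite mul1r norm_jmu.
Qed.

Lemma incl_isometric mu x y : hdot (incl mu x) (incl mu y) = hdot x y.
Proof.
have [lip _ E] := inclP mu; have [_ _ dense] := jmuC mu.
move: x; apply: (dense_lipschitz_eq (L := R[i]^o) dense).
- exact: (lipschitz_map_comp (lipschitz_hdotl _) lip).
- exact: lipschitz_hdotl.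
move=> _ [s Vs <-]; apply: (can_inj conjCK).
move: y; apply: (dense_lipschitz_eq (L := R[i]^o) dense).
- exact: (lipschitz_map_comp (lipschitz_hdotr _) lip).
- exact: lipschitz_hdotr.
by move=> _ [t Vt <-] /=; rewrite !E// hdot_jmu.
Qed.

(** For elementary tensors, inner products equal to 1 at almost all coordinates would make the unit
    vectors there equal by [unit_vector_eq], hence the classes equal; so [phi1] takes its default
    value 0. *)
Lemma completion_class_orthogonal (mu nu : classes) s t : mu <> nu ->
  Vmu mu s -> Vmu nu t -> hdot (j s) (j t) = 0.
Proof.
have [jL _ _] := jC.
have [u uU mu_u] := cofin_class_inhab mu; have [v vU nu_v] := cofin_class_inhab nu.
have V0 : V 0 by exact: lspan0.
have j0 : j 0 = 0.
  by apply: (completion0 _ jC V0) => c x y; exact: lspan_linear.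
move=> munu Vs Vt; move: s Vs.
rewrite (tensor_classE _ mu_u); apply: lspan_ind; first by rewrite j0 linear0l.
move=> c _ s [x xu <-].
move=> sU IH; have Vs : V s by apply: (@VmuV mu); rewrite (tensor_classE _ mu_u).
have xU : almost_unit x by apply: almost_all_sub xu => i ->.
rewrite jL//; last exact: tensor_un_almost.
rewrite hdotDl hdotZl IH addr0.
apply/eqP; rewrite mulf_eq0; apply/orP; right; apply/eqP => {c s sU Vs IH}.
move: t Vt; rewrite (tensor_classE _ nu_v); apply: lspan_ind; first by rewrite j0 linear0r.
move=> c _ t [y yv <-].
move=> tU IH; have Vt : V t by apply: (@VmuV nu); rewrite (tensor_classE _ nu_v).
have yU : almost_unit y by apply: almost_all_sub yv => i ->.
rewrite jL//; last exact: tensor_un_almost.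
rewrite hdotDr hdotZr IH addr0.
rewrite (completion_phi1 H_nonzero thH_tensor jC)// /phi1 asboolF ?mulr0//.
move=> xy; apply: munu; apply: (cofin_class_eq mu_u nu_v).
apply: almost_all_sub (almost_all_and xy (almost_all_and xu yv)) => i [xyi [xui yvi]].
by apply: unit_vector_eq => //; rewrite -xui -yvi.
Qed.

Lemma tensor_repr_direct_sum :
  is_direct_sum_repr (tensor_e thA) (tensor_repr thH thA Psi V j)
    (fun mu => tensor_repr thH thA Psi (Vmu mu) (jmu mu)) (fun mu => incl mu).
Proof.
have [jL _ jdense] := jC.
split.
- by move=> mu; have [] := inclP mu.
- exact: incl_isometric.
- move=> mu nu x y munu; have [lmu _ Emu] := inclP mu; have [lnu _ Enu] := inclP nu.
  have [_ _ dmu] := jmuC mu; have [_ _ dnu] := jmuC nu.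
  move: x; apply: (dense_lipschitz_eq (L := R[i]^o) dmu).
  + exact: (lipschitz_map_comp (lipschitz_hdotl _) lmu).
  + exact: lipschitz_map_cst.
  move=> _ [s Vs <-]; apply: (can_inj conjCK).
  move: y; apply: (dense_lipschitz_eq (L := R[i]^o) dnu).
  + exact: (lipschitz_map_comp (lipschitz_hdotr _) lnu).
  + exact: lipschitz_map_cst.
  by move=> _ [t Vt <-] /=; rewrite Emu// Enu// (completion_class_orthogonal munu).
- apply/seteqP; split => // x _.
  have : closure (j @` V) x by rewrite jdense.
  apply: closureS => _ [s Vs <-].
  have V0 : V 0 by exact: lspan0.
  have j0 : j 0 = 0.
    by apply: (completion0 _ jC V0) => c u v; exact: lspan_linear.
  move: s Vs; apply: lspan_ind; first by rewrite j0; exact: lspan0.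
  move=> c _ s [u uU <-] Vs IH; rewrite jL//; last first.
    by apply: tensor_un_almost => //; exact: almost_allT.
  apply: lspan_linear => //; apply: lspan_gen; pose mu : classes := cofin_class uU.
  have [_ _ E] := inclP mu; exists mu => //; exists (jmu mu (thH u)) => //; apply: E.
  rewrite (@tensor_classE _ _ _ _ _ _ _ u); last first.
    by split => //; exact: cofin_eq_refl.
  by apply: lspan_gen; exists u => //; exact: cofin_eq_refl.
- move=> a aE mu; have [lmu _ Emu] := inclP mu; have [_ _ dmu] := jmuC mu.
  have aut := tensor_e_ut aE.
  have [la _ aK] := tensor_repr_unP H_nonzero PsiR thA_tensor thH_tensor jC aut.
  (* The bound obtained on [tensor_un] serves on each class subspace, where [j] and [jmu mu] give
     equal norms. *)
  have [M M0 aM] := tensor_op_bounded H_nonzero PsiR thA_tensor thH_tensor jC aut.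
  have Vop s : Vmu mu s -> Vmu mu (op a s) by exact: tensor_class_op.
  have [lamu _ aKmu] : [/\ lipschitz_map (tensor_repr thH thA Psi (Vmu mu) (jmu mu) a),
      linear (tensor_repr thH thA Psi (Vmu mu) (jmu mu) a) &
      forall s, Vmu mu s ->
        tensor_repr thH thA Psi (Vmu mu) (jmu mu) a (jmu mu s) = jmu mu (op a s)].
    have [jmuL _ _] := jmuC mu.
    apply: (continuous_ext_bounded (VmuL (mu := mu)) (jmuC mu) M0) => [c u v Vu Vv|v Vv] /=.
      by rewrite tensor_op_linear// jmuL//; exact: Vop.
    have Vav := Vop _ Vv; have VVv := VmuV Vv.
    by rewrite !norm_jmu ?aM.
  apply: (dense_lipschitz_eq dmu).
  + exact: (lipschitz_map_comp la lmu).
  + exact: (lipschitz_map_comp lmu lamu).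
  move=> _ [s Vs <-]; have Vas := Vop _ Vs.
  have VVs := VmuV Vs; by rewrite /= Emu// aKmu// Emu// aK.
Qed.

End DirectSum.

(** * Linear algebra for the injectivity proof *)

Lemma almost_all_forall (J : finType) (I : Type) (P : J -> I -> Prop) :
  (forall k, almost_all (P k)) -> almost_all (fun i => forall k, P k i).
Proof.
move=> fP; apply: (@sub_finite_set _ _ (\bigcup_(k in [set: J]) [set i | ~ P k i])).
  by move=> i /= /existsNP[k nP]; exists k.
by apply: bigcup_finite => // k _; exact: fP.
Qed.

(** The terms are grouped by the value of [a]. The index [p l] represents the group of [l]: what
    [pick] returns depends only on the predicate, hence only on [a l]. *)
Lemma sum_by_value (R : realType) (T : Type) (W : lmodType R[i]) n
    (c : 'I_n -> R[i]) (a : 'I_n -> T) (g : T -> W) :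
  (forall k, \sum_(l < n | `[< a l = a k >]) c l = 0) ->
  \sum_(k < n) c k *: g (a k) = 0.
Proof.
move=> c0; pose p l := odflt l [pick k | `[< a l = a k >]].
have ap l : a (p l) = a l.
  by rewrite /p; case: pickP => [k /asboolP|//].
have pE k l : a k = a l -> p k = p l.
  move=> kl; rewrite /p kl; case: pickP => // /(_ l).
  by rewrite asboolT.
rewrite (partition_big p xpredT)//= big1// => k _.
have [[l plk]|nk] := pselect (exists l, p l = k); last first.
  by rewrite big_pred0// => l; apply/negP => /eqP pl; apply: nk; exists l.
have ak l' : (p l' == k) = `[< a l' = a k >].
  apply/eqP/asboolP => [<-|]; first by rewrite ap.
  by rewrite -plk ap => /pE; rewrite plk.
rewrite (eq_bigr (fun l => c l *: g (a k))); last first.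
  by move=> l'; rewrite ak => /asboolP ->.
by rewrite -scaler_suml (eq_bigl _ _ ak) c0 scale0r.
Qed.

(** Finitely many proper kernels do not cover [U]. If [x] avoids those of [s] and [y] that of [k],
    then each map vanishes at [m%:R *: y + x] for at most one natural [m]: two zeros would make it
    vanish at both [y] and [x]. *)
Lemma avoid_kernels (R : realType) (J : eqType) (U W : lmodType R[i])
    (T : J -> U -> W) (s : seq J) : (forall k, linear (T k)) ->
  (forall k, k \in s -> exists x, T k x <> 0) ->
  exists x, forall k, k \in s -> T k x <> 0.
Proof.
move=> TL; elim: s => [|k s IH] sT; first by exists 0.
have [|x xs] := IH; first by move=> l ls; apply: sT; rewrite in_cons ls orbT.
have [|y yk] := sT k; first exact: mem_head.
pose bad l := [set m : nat | T l (m%:R *: y + x) = 0].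
have bad_fin l : l \in k :: s -> finite_set (bad l).
  move=> lks; have bad1 m m' : bad l m -> bad l m' -> m = m'.
    rewrite /bad /= !TL => mE m'E; apply/eqP/negPn/negP => mm'.
    have mm'y : (m%:R - m'%:R) *: T l y = 0.
      rewrite scalerBl; apply/eqP; rewrite subr_eq0; apply/eqP/(addIr (T l x)).
      by rewrite mE m'E.
    have ly : T l y = 0.
      apply/eqP; move/eqP: mm'y; rewrite scaler_eq0 subr_eq0 eqr_nat.
      by rewrite (negbTE mm').
    move: lks; rewrite in_cons => /orP[/eqP lk|/xs]; first by apply: yk; rewrite -lk.
    by apply; rewrite -mE ly scaler0 add0r.
  have [[m mb]|nb] := pselect (exists m, bad l m); last first.
    rewrite (_ : bad l = set0); first exact: finite_set0.
    by apply/seteqP; split => // m mb; apply: nb; exists m.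
  apply: (@sub_finite_set _ _ [set m]); last exact: finite_set1.
  by move=> m' mb' /=; exact: bad1.
have : finite_set (\bigcup_(l in [set` k :: s]) bad l).
  by apply: bigcup_finite => //; exact: finite_seq.
have [[m mE]|] := pselect (exists m, ~ (\bigcup_(l in [set` k :: s]) bad l) m).
  exists (m%:R *: y + x) => l lks lE; apply: mE.
  by exists l.
move=> /forallNP all_bad fin; exfalso; apply: infinite_nat.
by apply: sub_finite_set fin => m _; exact: (contrapT (all_bad m)).
Qed.

(* The linear functionals [f] reduce [A ⊗ E] to [E]: solving one of the
   relations [sum_k f (a k) *: e k = 0] for some [e k] drops a term. *)
Lemma bilinear_separation (R : realType) (A E W : lmodType R[i])
    (beta : A -> E -> W) (F : set (A -> R[i]^o)) :
  (forall e, linear (beta ^~ e)) -> (forall a, linear (beta a)) ->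
  (forall f, F f -> linear f) -> (forall a, (forall f, F f -> f a = 0) -> a = 0) ->
  forall n (a : 'I_n -> A) (e : 'I_n -> E),
    (forall f, F f -> \sum_(k < n) f (a k) *: e k = 0) ->
    \sum_(k < n) beta (a k) (e k) = 0.
Proof.
move=> bl br FL Fsep; elim=> [|n IH] a e ae; first by rewrite big_ord0.
have [[f [Ff [k fk]]]|none] := pselect (exists f, F f /\ exists k, f (a k) <> 0); last first.
  rewrite big1// => k _; rewrite (Fsep (a k)) ?(linear_map0 (bl _))// => f Ff.
  by apply: contrapT => fk; apply: none; exists f; split => //; exists k.
pose r l := f (a (lift k l)) / f (a k).
have ek : e k = - \sum_(l < n) r l *: e (lift k l).
  have := ae f Ff; rewrite (bigD1_ord k)//= => /eqP; rewrite addr_eq0 => /eqP.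
  move=> /(congr1 (fun v => (f (a k))^-1 *: v)).
  rewrite scalerA mulVf ?scale1r; last exact/eqP.
  move=> ->; rewrite scalerN scaler_sumr; congr (- _); apply: eq_bigr => l _.
  by rewrite scalerA mulrC.
(* Substituting [ek] spreads the term [k] over the others; both the sum for [beta] and the relation
   of every [g] in [F] become those of [a']. *)
pose a' l := - r l *: a k + a (lift k l).
rewrite (bigD1_ord k)//= -[RHS](IH a' (e \o lift k)) => [|g Fg].
  rewrite /a' [RHS](eq_bigr (fun l => - (r l *: beta (a k) (e (lift k l))) + beta (a (lift k l)) (e (lift k l)))).
    rewrite big_split /= sumrN ek -scaleN1r (linear_mapZ (br _)) (linear_map_sum (br _)).
    by rewrite scaleN1r.
  by move=> l _; rewrite bl scaleNr.
have := ae g Fg; rewrite (bigD1_ord k)//= => aeg; rewrite -[RHS]aeg.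
rewrite /a' [LHS](eq_bigr (fun l => - (g (a k) *: (r l *: e (lift k l))) + g (a (lift k l)) *: e (lift k l))).
  by rewrite big_split /= sumrN -scaler_sumr ek scalerN.
by move=> l _; rewrite (FL _ Fg) scalerDl !scaleNr scalerA mulrC.
Qed.

(** Whether almost all factors are 1 does not depend on coordinate [i], so its factor splits off;
    [c] is the product of the others, or 0. This makes slicing at one coordinate possible. *)
Lemma phi1_dfwith2 (R : realType) (I : choiceType) (H : I -> hilbertType R)
    (x y : forall i, H i) (i : I) :
  exists c : R[i], forall v w, phi1 (dfwith x i v) (dfwith y i w) = c * hdot v w.
Proof.
pose P k := hdot (x k) (y k) = 1.
have out v w k : k != i ->
    hdot (dfwith x i v k) (dfwith y i w k) = hdot (x k) (y k).
  by move=> ki; rewrite !dfwithout// eq_sym.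
have PE v w : almost_all (fun k => hdot (dfwith x i v k) (dfwith y i w k) = 1) =
              almost_all P.
  by apply: (@almost_all_eq _ _ _ i) => k ki; rewrite out.
have [P0|nP0] := pselect (almost_all P); last first.
  by exists 0 => v w; rewrite /phi1 PE asboolF// mul0r.
exists (\big[*%R/1]_(k \in [set k | hdot (x k) (y k) <> 1] `\ i) hdot (x k) (y k)) => v w.
have Pvw : almost_all (fun k => hdot (dfwith x i v k) (dfwith y i w k) = 1) by rewrite PE.
rewrite /phi1 asboolT// (fsprod_split i Pvw) !dfwithin mulrC; congr (_ * _).
have -> : [set k | hdot (dfwith x i v k) (dfwith y i w k) <> 1] `\ i =
          [set k | hdot (x k) (y k) <> 1] `\ i.
  by apply/seteqP; split=> k [/= h ki]; split => //; move: h; rewrite out//; apply/eqP.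
by apply: eq_fsbigr => k; rewrite inE => -[_ /= ki]; rewrite out//; apply/eqP.
Qed.

(** * Combinations of elementary tensors with vanishing matrix coefficients *)

Section Injectivity.
Variables (R : realType) (I : choiceType).
Variables (A : I -> starAlgType R) (H : I -> hilbertType R).
Variables (Psi : forall i, A i -> H i -> H i).
Arguments Psi : clear implicits.
Variables (TA : starAlgType R) (thA : (forall i, A i) -> TA).
Hypothesis H_nonzero : forall i, exists x : H i, x != 0.
Hypothesis PsiR : forall i, unital_star_repr [set: A i] (Psi i).
Hypothesis Psi_inj : forall i, injective (Psi i).
Hypothesis thA_tensor : is_tensor_star_algebra thA.

Local Notation act a x := (fun i => Psi i (a i) (x i)).

Let unit_vectors (x : forall i, H i) := forall i, unit_sphere (x i).

Lemma act_dfwith a x i b v :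
  act (dfwith a i b) (dfwith x i v) = dfwith (act a x) i (Psi i b v).
Proof.
apply: functional_extensionality_dep => k.
by case: (eqVneq i k) => [<-|ik]; [rewrite !dfwithin|rewrite !dfwithout].
Qed.

Lemma repr_injective_eq0 i (b : A i) : (forall x, Psi i b x = 0) -> b = 0.
Proof.
move=> b0; apply: (Psi_inj (i := i)); apply/funext => x; rewrite b0.
have := repr_semilinear (PsiR i) (-1) 1 1 x.
by rewrite scaleN1r addNr repr1// => ->; rewrite scaleN1r addNr.
Qed.

(** A nonzero [Psi i b v] is detected by its own normalization as [w]. *)
Lemma vector_functional_separation i (b : A i) :
  (forall v w, unit_sphere v -> unit_sphere w -> hdot (Psi i b v) w = 0) -> b = 0.
Proof.
move=> b0; apply: repr_injective_eq0 => x.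
have [c [v [vU ->]]] := scaled_unit_vector x (H_nonzero i).
rewrite (linear_mapZ (repr_linear (PsiR i) b)).
suff -> : Psi i b v = 0 by rewrite scaler0.
apply: contrapT => /eqP bv.
have := b0 v _ vU (normalize_unit bv); rewrite hdotZr => /eqP.
rewrite mulf_eq0 fmorph_eq0 invr_eq0 normr_eq0 (negbTE bv) /=.
by rewrite -sqr_norm_hdot sqrf_eq0 normr_eq0 (negbTE bv).
Qed.

(** At each coordinate the vector must avoid the kernels of the differences of distinct operators,
    which are proper by injectivity. *)
Lemma separating_unit_vectors n (a : 'I_n -> forall i, A i) :
  exists2 x, unit_vectors x &
    forall k l i, a k i <> a l i -> Psi i (a k i) (x i) <> Psi i (a l i) (x i).
Proof.
suff sep i : exists x, unit_sphere x /\
    forall k l, a k i <> a l i -> Psi i (a k i) x <> Psi i (a l i) x.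
  exists (fun i => projT1 (cid (sep i))) => [i|k l i]; case: cid => x [] //=.
  by move=> _; apply.
(* [None] stands for the identity map, whose kernel is avoided to keep the vector nonzero and
   normalizable. *)
pose T (q : option ('I_n * 'I_n)) (v : H i) : H i :=
  if q is Some kl then Psi i (a kl.1 i) v - Psi i (a kl.2 i) v else v.
pose s := None :: [seq Some kl | kl <- enum [pred kl | `[< a kl.1 i <> a kl.2 i >]]].
have [||x xs] := @avoid_kernels _ _ _ _ T s.
- case=> [kl|] c u v //=; rewrite !(repr_linear (PsiR i)) scalerBr.
  by rewrite opprD addrACA.
- move=> q; rewrite in_cons => /orP[/eqP ->|].
    by have [e /eqP e0] := H_nonzero i; exists e.
  move=> /mapP[kl]; rewrite mem_enum inE /= => kl_neq ->.
  apply: contrapT => /forallNP T0; apply: kl_neq; apply: (Psi_inj (i := i)).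
  apply/funext => v; apply/eqP; rewrite -subr_eq0; apply/eqP.
  exact: (contrapT (T0 v)).
have x0 : x != 0 by apply/eqP/(xs None); rewrite in_cons eqxx.
exists (`|x|^-1 *: x); split; first exact: normalize_unit.
move=> k l kl; rewrite !(linear_mapZ (repr_linear (PsiR i) _)).
move=> /(congr1 (fun v => `|x| *: v)); rewrite !scalerA divff ?normr_eq0//.
rewrite !scale1r => /eqP; rewrite -subr_eq0 => /eqP.
apply: (xs (Some (k, l))); rewrite in_cons /=; apply: map_f.
by rewrite mem_enum inE.
Qed.

(* The matrix coefficients of the operator defined by [\sum_k c k *: thA (a k)]
   vanish. *)
Definition null_coefficients n (c : 'I_n -> R[i]) (a : 'I_n -> forall i, A i) : Prop :=
  forall x y, unit_vectors x -> unit_vectors y ->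
    \sum_(k < n) c k * phi1 (act (a k) x) y = 0.

(** For a separating [x], the coefficient of [a l] between [x] and [act (a k) x] is 1 if
    [a l = a k]. Otherwise it is 0, since a nonzero value would make [a l] and [a k] agree at almost
    all coordinates. So the scalars of equal families sum to 0. *)
Lemma null_unitary_combination n (c : 'I_n -> R[i]) (a : 'I_n -> forall i, A i) :
  (forall k i, unitary (a k i)) ->
  (forall k l, a k = a l \/ ~ cofin_eq (a k) (a l)) ->
  null_coefficients c a -> \sum_(k < n) c k *: thA (a k) = 0.
Proof.
move=> aU acof ac0; apply: (sum_by_value thA) => k.
have [x xU sep] := separating_unit_vectors a.
have actU l : unit_vectors (act (a l) x).
  by move=> i; rewrite /unit_sphere /= unitary_isometric//; exact: xU.
rewrite -[RHS](ac0 x (act (a k) x))// [LHS]big_mkcond /=; apply: eq_bigr => l _.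
case: asboolP => [->|lk].
  have kk1 i : hdot (Psi i (a k i) (x i)) (Psi i (a k i) (x i)) = 1.
    by apply: unit_vector_inner; exact: actU.
  rewrite /phi1 asboolT; last exact: almost_allT.
  by rewrite fsbig1 ?mulr1// => i _; exact: kk1.
rewrite /phi1 asboolF ?mulr0// => ae1.
have [//|] := acof l k; apply; apply: almost_all_sub ae1 => i /unit_vector_eq e.
apply: contrapT => /sep; apply; apply: e; exact: actU.
Qed.

(** Induction on the exceptional coordinates: [thA (a k)] factors into its entry at [i] and the
    family with 1 at [i], and [bilinear_separation] by matrix coefficients of [Psi i] leaves slices
    with fewer exceptions. *)
Lemma null_combination (F : seq I) n (c : 'I_n -> R[i]) (a : 'I_n -> forall i, A i) :
  (forall k i, i \notin F -> unitary (a k i)) ->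
  (forall k l, (forall i, i \notin F -> a k i = a l i) \/ ~ cofin_eq (a k) (a l)) ->
  null_coefficients c a -> \sum_(k < n) c k *: thA (a k) = 0.
Proof.
have [[thm _] thM _ _] := thA_tensor.
elim: F n c a => [|i F IH] n c a aU acof ac0.
  apply: null_unitary_combination => // [k i|k l]; first exact: aU.
  have [kl|] := acof k l; [left|by right].
  by apply: functional_extensionality_dep => i; exact: kl.
pose one : forall k, A k := fun=> 1.
pose beta (b : A i) (e : TA) := thA (dfwith one i b) * e.
pose fam := [set f : A i -> R[i]^o | exists v w, [/\ unit_sphere v, unit_sphere w &
  f = fun b => hdot (Psi i b v) w]].
have aE k : c k *: thA (a k) = beta (a k i) (c k *: thA (dfwith (a k) i 1)).
  rewrite /beta -scalerAr -thM; congr (_ *: thA _).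
  apply: functional_extensionality_dep => m.
  by case: (eqVneq i m) => [<-|im]; [rewrite !dfwithin mulr1|rewrite !dfwithout// mul1r].
rewrite (eq_bigr _ (fun k _ => aE k)); apply: (bilinear_separation (F := fam)).
- by move=> e d b b'; rewrite /beta (thm one i d b b') mulrDl scalerAl.
- by move=> b d e e'; rewrite /beta mulrDr scalerAr.
- move=> _ [v [w [_ _ ->]]] d b b'.
  by rewrite (repr_semilinear (PsiR i)) hdotDl hdotZl.
- move=> b b0; apply: vector_functional_separation => v w vU wU.
  by apply: (b0 (fun b => hdot (Psi i b v) w)); exists v, w.
move=> _ [v [w [vU wU ->]]].
under eq_bigr do rewrite scalerA mulrC.
apply: (IH n (fun k => c k * hdot (Psi i (a k i) v) w)) => [k m mF|k l|x y xU yU].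
- case: (eqVneq i m) => [<-|im]; first by rewrite dfwithin; exact: unitary1.
  by rewrite dfwithout//; apply: aU; rewrite in_cons negb_or eq_sym im.
- have [kl|nkl] := acof k l; [left|right].
    move=> m mF; case: (eqVneq i m) => [<-|im]; first by rewrite !dfwithin.
    by rewrite !dfwithout//; apply: kl; rewrite in_cons negb_or eq_sym im.
  move=> kl; apply: nkl; move: kl; rewrite /cofin_eq.
  by rewrite (@almost_all_eq _ _ (fun m => a k m = a l m) i)// => m mi; rewrite !dfwithout// eq_sym.
have dfU (z : forall k, H k) u : unit_vectors z -> unit_sphere u -> unit_vectors (dfwith z i u).
  move=> zU uU m; case: (eqVneq i m) => [<-|im]; first by rewrite dfwithin.
  by rewrite dfwithout.
have := ac0 _ _ (dfU _ _ xU vU) (dfU _ _ yU wU).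
(* The hypothesis at [v], [w] lacks the factor [hdot (x i) (y i)], which the slice has because its
   entry at [i] is 1. *)
move=> /(congr1 (fun z => hdot (x i) (y i) * z)); rewrite mulr0 big_distrr /= => E.
rewrite -[RHS]E; apply: eq_bigr => k _.
have [d dE] := phi1_dfwith2 (act (a k) x) y i.
have -> : act (a k) (dfwith x i v) = dfwith (act (a k) x) i (Psi i (a k i) v).
  by rewrite -act_dfwith dfwith_eta.
have -> : act (dfwith (a k) i 1) x = dfwith (act (a k) x) i (x i).
  by rewrite -[in LHS](dfwith_eta x i) act_dfwith repr1.
rewrite -[in LHS](dfwith_eta y i) !dE; ring.
Qed.

(** With finitely many families, one finite [F] contains all their nonunitary coordinates and all
    differences between families that are cofinitely equal. *)
Lemma null_combination_almost_unitary n (c : 'I_n -> R[i]) (a : 'I_n -> forall i, A i) :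
  (forall k, almost_unitary (a k)) ->
  null_coefficients c a -> \sum_(k < n) c k *: thA (a k) = 0.
Proof.
move=> aU.
have /almost_all_seqP[F FP] : almost_all (fun i => forall kl : 'I_n * 'I_n,
    unitary (a kl.1 i) /\ (cofin_eq (a kl.1) (a kl.2) -> a kl.1 i = a kl.2 i)).
  apply: almost_all_forall => -[k l] /=; apply: almost_all_and; first exact: aU.
  have [kl|nkl] := pselect (cofin_eq (a k) (a l)); last exact: almost_allT.
  by apply: almost_all_sub kl.
apply: (null_combination (F := F)) => [k i /FP/(_ (k, k))[]//|k l].
have [kl|nkl] := pselect (cofin_eq (a k) (a l)); [left|by right].
by move=> i /FP/(_ (k, l))[_]; apply.
Qed.

End Injectivity.

(** * Injectivity of the representation, part (c) *)

Section InjectiveRepresentation.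
Variables (R : realType) (I : choiceType).
Variables (A : I -> starAlgType R) (H : I -> hilbertType R).
Variables (Psi : forall i, A i -> H i -> H i).
Arguments Psi : clear implicits.
Variables (TA : starAlgType R) (thA : (forall i, A i) -> TA).
Variables (TH : lmodType R[i]) (thH : (forall i, H i) -> TH).
Variables (K : hilbertType R) (j : TH -> K).
Hypothesis H_nonzero : forall i, exists x : H i, x != 0.
Hypothesis PsiR : forall i, unital_star_repr [set: A i] (Psi i).
Hypothesis thA_tensor : is_tensor_star_algebra thA.
Hypothesis thH_tensor : is_tensor_product thH.
Hypothesis jC : is_completion (tensor_un thH) (phi1_ip thH) j.

(** The difference [d] of two elements with the same image acts as 0 under [j]; pairing with
    elementary tensors of unit vectors shows that its matrix coefficients vanish. *)
Lemma tensor_repr_injective : (forall i, injective (Psi i)) ->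
  {in tensor_ut thA &, injective (tensor_repr thH thA Psi (tensor_un thH) j)}.
Proof.
move=> Psi_inj a b; rewrite !inE => aU bU ab.
have [jL jip _] := jC; have [tA _ _ _] := thA_tensor.
pose d := -1 *: b + a.
have dU : tensor_ut thA d by move: aU bU; rewrite tensor_utE /d => aU bU; exact: lspan_linear.
suff d0 : d = 0 by move/eqP: d0; rewrite /d scaleN1r addrC subr_eq0 => /eqP.
have jd s : tensor_un thH s -> j (tensor_op thH thA Psi d s) = 0.
  move=> Vs.
  have [_ _ <-] := tensor_repr_unP H_nonzero PsiR thA_tensor thH_tensor jC dU; last by [].
  have [_ lin _ _ _] := tensor_repr_unital_star H_nonzero PsiR thA_tensor thH_tensor jC.
  by rewrite lin// ab scaleN1r addNr.
have := dU; rewrite tensor_utE => -[n [c [s [sU dE]]]].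
have /choice[u uP] : forall k, exists u, almost_unitary u /\ thA u = s k.
  by move=> k; have [u uU us] := sU k; exists u.
have dEu : d = \sum_(k < n) c k *: thA (u k).
  by rewrite dE; apply: eq_bigr => k _; have [_ ->] := uP k.
rewrite dEu; apply: (null_combination_almost_unitary H_nonzero PsiR Psi_inj thA_tensor).
  by move=> k; have [] := uP k.
move=> x y xU yU.
have Vx : tensor_un thH (thH x) by apply: lspan_gen; exists x.
have Vy : tensor_un thH (thH y) by apply: lspan_gen; exists y.
have := jip _ _ (tensor_un_op H_nonzero PsiR thA_tensor thH_tensor dU Vx) Vy.
rewrite jd// linear0l dEu.
rewrite (linear_map_sum (f := (tensor_op thH thA Psi)^~ (thH x))); last first.
  by move=> e v w; exact: tensor_op_linearl.
rewrite (linear_map_sum (W := R[i]^o) (f := phi1_ip thH ^~ (thH y))); last first.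
  exact: tensor_lift_linear.
move=> E; rewrite [RHS]E; apply: eq_bigr => k _.
by rewrite tensor_opE// phi1_ipE.
Qed.

End InjectiveRepresentation.

Theorem theorem5p3 (R : realType) (I : choiceType)
  (A : I -> starAlgType R) (H : I -> hilbertType R)
  (Psi : forall i, A i -> H i -> H i)
  (TA : starAlgType R) (thA : (forall i, A i) -> TA)
  (TH : lmodType R[i]%C) (thH : (forall i, H i) -> TH)
  (K : hilbertType R) (j : TH -> K)
  (Kmu : cofin_classes (fun i => @unit_sphere R (H i)) -> hilbertType R)
  (jmu : forall mu, TH -> Kmu mu)
  (I_infinite : infinite_set [set: I])
  (H_nonzero : forall i, exists x : H i, x != 0)
  (Psi_repr : forall i, unital_star_repr [set: A i] (Psi i))
  (thA_tensor : is_tensor_star_algebra thA)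
  (thH_tensor : is_tensor_product thH)
  (K_completion : is_completion (tensor_un thH) (phi1_ip thH) j)
  (Kmu_completion : forall mu,
     is_completion (tensor_class thH mu) (phi1_ip thH) (jmu mu)) :
  let Psi_phi1 := tensor_repr thH thA Psi (tensor_un thH) j in
  let Psi_mu mu := tensor_repr thH thA Psi (tensor_class thH mu) (jmu mu) in
  let incl mu := continuous_ext (tensor_class thH mu) (jmu mu) j in
  [/\ (* (a) *)
      [/\ forall a, tensor_ut thA a -> forall s, tensor_un thH s ->
             tensor_un thH (tensor_op thH thA Psi a s),
          forall a, tensor_ut thA a -> forall s, tensor_un thH s ->
             Psi_phi1 a (j s) = j (tensor_op thH thA Psi a s) &
          unital_star_repr (tensor_ut thA) Psi_phi1],
      (* (b) *)
      is_direct_sum_repr (tensor_e thA) Psi_phi1 Psi_mu incl &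
      (* (c) *)
      (forall i, injective (Psi i)) ->
        {in tensor_ut thA &, injective Psi_phi1}].
Proof.
move=> Psi_phi1 Psi_mu incl; split.
- split.
  + by move=> a aU s; exact: (tensor_un_op H_nonzero Psi_repr thA_tensor thH_tensor).
  + move=> a aU s Vs.
    have [_ _ E] := tensor_repr_unP H_nonzero Psi_repr thA_tensor thH_tensor K_completion aU.
    exact: E.
  + exact: (tensor_repr_unital_star H_nonzero Psi_repr thA_tensor thH_tensor K_completion).
- exact: (tensor_repr_direct_sum H_nonzero Psi_repr thA_tensor thH_tensor K_completion Kmu_completion).
- exact: (tensor_repr_injective H_nonzero Psi_repr thA_tensor thH_tensor K_completion).
Qed.
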